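(* Each element of the Shimura family associated to every member of the family $\mathcal{F}_5$ admits a period matrix $(I_5\ Z)$ with $Z\in\mathscr{H}_5$ of the form $$Z=\begin{pmatrix} 2(u+v+w) & -w-u & -2v & -v-w-u & -v+u\\ -w-u & -v+\tfrac12 w+\tfrac54 u & v-\tfrac12u & w+\tfrac12u & v-u\\ -2v & v-\tfrac12u & u & v & w\\ -v-w-u & w+\tfrac12u & v & u & -w\\ -v+u & v-u & w & -w & 2(u-v-w) \end{pmatrix}$$ for some $u,v,w\in\mathbb{C}$.
   Context: $\mathcal{F}_5$ denotes the family of compact Riemann surfaces $S$ of genus $5$ with exactly $20$ automorphisms; each has $\mathrm{Aut}(S)\cong\mathbf{D}_{10}=\langle r,s:r^{10}=s^2=(sr)^2=1\rangle$, with $S/\mathrm{Aut}(S)$ of genus $0$, and the action is represented by the generating vector $(s,sr^{-2},r^5,r^7)$ of type $(2,2,2,10)$ (local monodromies of $S\to S/\mathrm{Aut}(S)$ around its four branch values). $\mathscr{H}_g=\{Z\in M(g,\mathbb{C}):Z=Z^t,\ \mathrm{Im}(Z)>0\}$ is the Siegel space; $Z\in\mathscr{H}_g$ represents the principally polarized abelian variety with period matrix $(I_g\ Z)$. For a compact Riemann surface $S$ of genus $g\ge2$, let $L_S=\mathrm{End}_{\mathbb{Q}}(JS)=\mathrm{End}(JS)\otimes_{\mathbb{Z}}\mathbb{Q}$. Fixing a symplectic basis of $H_1(S,\mathbb{Z})$ determines a period matrix $(I_g\ Z_S)$ of $JS$ and a rational representation of $L_S$. The Shimura family of $S$ is the complex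 submanifold $\mathbb{H}(L_S)\subset\mathscr{H}_g$ whose points are the matrices representing principally polarized abelian varieties containing $L_S$ (through this fixed rational representation) in their endomorphism algebras. For $S\in\mathcal{F}_5$ and a suitable symplectic basis, the symplectic representation $\rho:\mathbf{D}_{10}\to\mathrm{Sp}(10,\mathbb{Z})$ induced by the action is $\rho(r)=\mathrm{diag}(R,(R^t)^{-1})$, $\rho(s)=\mathrm{diag}(S_0,S_0^t)$ with $$R=\begin{pmatrix}-1&0&1&-1&1\\1&1&0&1&0\\0&0&0&-1&0\\1&0&0&1&-1\\0&-2&0&1&-1\end{pmatrix},\qquad S_0=\begin{pmatrix}-1&0&1&-1&1\\0&-1&-1&1&-1\\0&0&0&-1&0\\0&0&-1&0&0\\0&0&0&0&1\end{pmatrix},$$ where $\mathrm{Sp}(10,\mathbb{Z})$ acts on $\mathscr{H}_5$ by $\left(\left(\begin{smallmatrix}A&B\\C&D\end{smallmatrix}\right),Z\right)\mapsto(A+ZC)^{-1}(B+ZD)$. *)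

(* Defs.v *)
From HB Require Import structures.
From mathcomp Require Import all_boot all_order all_algebra.
From mathcomp Require Import all_classical all_reals all_analysis.
From mathcomp Require Import complex freeg.

Set Implicit Arguments.
Unset Strict Implicit.
Unset Printing Implicit Defensive.

Import Order.TTheory GRing.Theory Num.Theory.
Import numFieldNormedType.Exports.

Local Open Scope classical_set_scope.
Local Open Scope complex_scope.
Local Open Scope ring_scope.

Definition Cplx (R : realType) : numClosedFieldType := R[i].

(* A holomorphic atlas, indexed by the points of the surface: [chart p] is a
   local coordinate on the open neighbourhood [chart_dom p] of [p], and [param p] is
   its inverse.  Outside [chart_dom p] (resp. outside the image of [chart_dom p]) the values
   of [chart p] (resp. [param p]) are irrelevant.  A function on an open set is
   holomorphic when it is complex differentiable at each point. *)
Record riemann_surface (R : realType) := RiemannSurface {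
  points :> topologicalType;
  points_hausdorff : hausdorff_space points;
  points_connected : connected [set: points];
  chart_dom : points -> set points;
  chart : points -> points -> Cplx R;
  param : points -> Cplx R -> points;
  dom_open : forall p, open (chart_dom p);
  dom_center : forall p, chart_dom p p;
  chart_open : forall p, open (chart p @` chart_dom p);
  chartK : forall p x, chart_dom p x -> param p (chart p x) = x;
  chart_continuous : forall p x, chart_dom p x -> {for x, continuous (chart p)};
  param_continuous :
    forall p x, chart_dom p x -> {for chart p x, continuous (param p)};
  transition_holomorphic : forall p q x, chart_dom p x -> chart_dom q x ->
    derivable (chart q \o param p) (chart p x) 1
}.

Definition holomorphic (R : realType) (S T : riemann_surface R) (f : S -> T) :=
  continuous f /\
  forall p q x, chart_dom p x -> chart_dom q (f x) ->
    derivable (chart q \o f \o param p) (chart p x) 1.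

Definition automorphism (R : realType) (S : riemann_surface R) (f : S -> S) :=
  holomorphic f /\ exists g : S -> S, [/\ holomorphic g, cancel f g & cancel g f].

(* A (1,0)-form is encoded by the function [w] such that the form is
   [w x * d (chart x)] in the cotangent line at [x].  In the coordinate
   [z = chart p] it is [form_coef w p z * dz]. *)
Definition form_coef (R : realType) (S : riemann_surface R) (w : S -> Cplx R)
    (p : S) (z : Cplx R) : Cplx R :=
  w (param p z) * derive1 (chart (param p z) \o param p) z.

Definition holomorphic_form (R : realType) (S : riemann_surface R)
    (w : S -> Cplx R) :=
  forall p x, chart_dom p x -> derivable (form_coef w p) (chart p x) 1.

Definition form_basis (R : realType) (S : riemann_surface R) (g : nat)
    (w : 'I_g -> S -> Cplx R) :=
  (forall i, holomorphic_form (w i)) /\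
  forall h : S -> Cplx R, holomorphic_form h ->
    exists! a : 'rV[Cplx R]_g, forall x, h x = \sum_(i < g) a 0 i * w i x.

Definition has_genus (R : realType) (S : riemann_surface R) (g : nat) :=
  exists w : 'I_g -> S -> Cplx R, form_basis w.

Definition C1_real (R : realType) (V : normedModType R) (f : V -> R) (x : V) :=
  forall v : V, derivable f x v /\ {for x, continuous (fun y => 'D_v f y)}.

Definition C1_map (R : realType) (V : normedModType R) (S : riemann_surface R)
    (f : V -> S) :=
  continuous f /\
  forall p x, chart_dom p (f x) ->
    C1_real (fun y => complex.Re (chart p (f y))) x /\
    C1_real (fun y => complex.Im (chart p (f y))) x.

(* Derivative at time [t] of the path [gamma] in the coordinate [chart p]. *)
Definition velocity (R : realType) (S : riemann_surface R) (p : S)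
    (gamma : R -> S) (t : R) : Cplx R :=
  derive1 (fun u => complex.Re (chart p (gamma u))) t +i*
  derive1 (fun u => complex.Im (chart p (gamma u))) t.

(* The integral of the form [w] along the restriction of [gamma] to [0, 1]. *)
Definition path_integral (R : realType) (S : riemann_surface R)
    (w : S -> Cplx R) (gamma : R -> S) : Cplx R :=
  let F t : Cplx R := w (gamma t) * velocity (gamma t) gamma t in
  (\int[lebesgue_measure]_(t in `[0, 1]) complex.Re (F t)) +i*
  (\int[lebesgue_measure]_(t in `[0, 1]) complex.Im (F t)).

Definition chain (R : realType) (S : riemann_surface R) :=
  {freeg ({t : R | (0 <= t <= 1)%R} -> S) / int}.

(* A C^1 singular simplex is the restriction of a C^1 map defined on the whole
   affine space; only the restriction enters the chain. *)
Definition simplex (R : realType) (S : riemann_surface R) (gamma : R -> S) :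
    chain S :=
  << fun t : {t : R | (0 <= t <= 1)%R} => gamma (val t) >>.

(* The vertices of the standard triangle are (0,0), (1,0), (0,1). *)
Definition triangle_boundary (R : realType) (S : riemann_surface R)
    (sigma : (R * R)%type -> S) : chain S :=
  simplex (fun t => sigma (1 - t, t)) - simplex (fun t => sigma (0, t))
  + simplex (fun t => sigma (t, 0)).

Definition homologous (R : realType) (S : riemann_surface R) (x y : chain S) :=
  exists (n : nat) (k : 'I_n -> int) (sigma : 'I_n -> (R * R)%type -> S),
    (forall i, C1_map (sigma i)) /\
    x - y = \sum_(i < n) triangle_boundary (sigma i) *~ k i.

Definition singular_cycle (R : realType) (S : riemann_surface R) (x : chain S) :=
  exists (n : nat) (k : 'I_n -> int) (gamma : 'I_n -> R -> S),
    [/\ forall i, C1_map (gamma i),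
        x = \sum_(i < n) simplex (gamma i) *~ k i
      & \sum_(i < n) (<< gamma i 1 >> - << gamma i 0 >>) *~ k i
          = 0 :> {freeg S / int}].

Definition closed_curve (R : realType) (S : riemann_surface R)
    (gamma : R -> S) :=
  C1_map gamma /\ forall t, gamma (t + 1) = gamma t.

(* Since [S] is connected, every class in H_1(S, Z) is the class of a closed
   curve, so bases of H_1(S, Z) may be given by closed curves. *)
Definition homology_basis (R : realType) (S : riemann_surface R) (m : nat)
    (c : 'I_m -> R -> S) :=
  (forall i, closed_curve (c i)) /\
  forall x : chain S, singular_cycle x ->
    exists! n : 'rV[int]_m,
      homologous x (\sum_(i < m) simplex (c i) *~ n 0 i).

(* Column j of [M] expresses the class of [d j] in terms of the classes of the
   [c i]. *)
Definition coordinates (R : realType) (S : riemann_surface R) (m : nat)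
    (c d : 'I_m -> R -> S) (M : 'M[int]_m) :=
  forall j, homologous (simplex (d j)) (\sum_(i < m) simplex (c i) *~ M i j).

Definition crossings (R : realType) (S : riemann_surface R)
    (gamma delta : R -> S) : set (R * R) :=
  [set p | [/\ 0 <= p.1 < 1, 0 <= p.2 < 1 & gamma p.1 = delta p.2]].

(* The determinant of the pair of velocities, in a coordinate at the common
   point: positive when they form a direct basis of the tangent plane. *)
Definition crossing_det (R : realType) (S : riemann_surface R)
    (gamma delta : R -> S) (p : R * R) : R :=
  let a := velocity (gamma p.1) gamma p.1 in
  let b := velocity (gamma p.1) delta p.2 in
  complex.Re a * complex.Im b - complex.Im a * complex.Re b.

Definition transversal_curves (R : realType) (S : riemann_surface R)
    (gamma delta : R -> S) :=
  forall p, crossings gamma delta p -> crossing_det gamma delta p != 0.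

(* The intersection form is the bilinear form on H_1(S, Z) which counts, with
   signs, the crossings of transversal closed curves.  Any two classes have
   transversal representatives, so this characterizes [b] on cycles; its values
   elsewhere are irrelevant. *)
Definition intersection_form (R : realType) (S : riemann_surface R)
    (b : chain S -> chain S -> int) :=
  [/\ forall x x' y, singular_cycle x -> singular_cycle x' -> singular_cycle y ->
        b (x + x') y = b x y + b x' y,
      forall x y, singular_cycle x -> singular_cycle y -> b y x = - b x y,
      forall x x' y, singular_cycle x -> singular_cycle x' -> singular_cycle y ->
        homologous x x' -> b x y = b x' y
    & forall gamma delta, closed_curve gamma -> closed_curve delta ->
        transversal_curves gamma delta ->
        (b (simplex gamma) (simplex delta))%:~R =
        \sum_(p \in crossings gamma delta) Num.sg (crossing_det gamma delta p)].

Definition J_std (A : pzRingType) (g : nat) : 'M[A]_(g + g) :=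
  block_mx 0 1%:M (- 1%:M) 0.

Definition symplectic_basis (R : realType) (S : riemann_surface R)
    (b : chain S -> chain S -> int) (g : nat) (c : 'I_(g + g) -> R -> S) :=
  homology_basis c /\
  forall i j, b (simplex (c i)) (simplex (c j)) = J_std int g i j.

(* [Z] is the matrix such that (I Z) is the period matrix of the Jacobian of
   [S] in the basis [c] = (a_1, ..., a_g, b_1, ..., b_g). *)
Definition period_matrix (R : realType) (S : riemann_surface R) (g : nat)
    (c : 'I_(g + g) -> R -> S) (Z : 'M[Cplx R]_g) :=
  exists w : 'I_g -> S -> Cplx R,
    form_basis w /\
    forall i j, path_integral (w i) (c (lshift g j)) = (i == j)%:R /\
                path_integral (w i) (c (rshift g j)) = Z i j.

Definition siegel (R : realType) (g : nat) (Z : 'M[Cplx R]_g) :=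
  Z^T = Z /\
  forall x : 'cV[R]_g, x != 0 ->
    0 < (x^T *m map_mx (@complex.Im R) Z *m x) 0 0.

Definition symplectic (g : nat) (N : 'M[int]_(g + g)) :=
  N^T *m J_std int g *m N = J_std int g.

(* (A B; C D) . Z = (A + Z C)^-1 (B + Z D): the normalization of (I Z) (A B; C D),
   i.e. the effect on Z of the change of basis with matrix (A B; C D). *)
Definition sp_act (R : realType) (g : nat) (N : 'M[int]_(g + g))
    (Z : 'M[Cplx R]_g) : 'M[Cplx R]_g :=
  let N' : 'M[Cplx R]_(g + g) := map_mx intr N in
  invmx (ulsubmx N' + Z *m dlsubmx N') *m (ursubmx N' + Z *m drsubmx N').

(* The image of End_Q(X), X = C^g / (I Z) Z^2g, under the rational
   representation: [A] is the analytic representation.  Integral [M] give End(X)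
   and clearing denominators gives End(X) (x) Q. *)
Definition rational_endomorphism (R : realType) (g : nat) (Z : 'M[Cplx R]_g)
    (M : 'M[rat]_(g + g)) :=
  exists A : 'M[Cplx R]_g,
    A *m row_mx 1%:M Z = row_mx 1%:M Z *m map_mx ratr M.

(* The points of the Shimura family of a curve whose Jacobian has period matrix
   (I ZS). *)
Definition shimura_family (R : realType) (g : nat) (ZS Z : 'M[Cplx R]_g) :=
  siegel Z /\
  forall M, rational_endomorphism ZS M -> rational_endomorphism Z M.

Definition F5 (R : realType) (S : riemann_surface R) :=
  [/\ compact [set: S], has_genus S 5
    & [set f : S -> S | automorphism f] #= `I_20]%card.

(* [r] and [s] generate Aut(S) and satisfy r^n = s^2 = (sr)^2 = 1.  When Aut(S)
   has order 2n this presents it as the dihedral group of order 2n. *)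
Definition dihedral_generators (R : realType) (S : riemann_surface R) (n : nat)
    (r s : S -> S) :=
  [/\ automorphism r, automorphism s,
      [/\ iter n r =1 id, s \o s =1 id & (s \o r) \o (s \o r) =1 id]
    & forall f : S -> S, automorphism f ->
        exists i : nat, f =1 iter i r \/ f =1 s \o iter i r].

Definition mx_of_rows (A : pzRingType) (n : nat) (rows : seq (seq A)) : 'M[A]_n :=
  \matrix_(i, j) nth 0 (nth [::] rows i) j.

Definition R_mx : 'M[int]_5 := mx_of_rows 5
  [:: [:: -1;  0;  1; -1;  1];
      [::  1;  1;  0;  1;  0];
      [::  0;  0;  0; -1;  0];
      [::  1;  0;  0;  1; -1];
      [::  0; -2;  0;  1; -1]].

Definition S0_mx : 'M[int]_5 := mx_of_rows 5
  [:: [:: -1;  0;  1; -1;  1];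
      [::  0; -1; -1;  1; -1];
      [::  0;  0;  0; -1;  0];
      [::  0;  0; -1;  0;  0];
      [::  0;  0;  0;  0;  1]].

Definition rho_r : 'M[int]_(5 + 5) := block_mx R_mx 0 0 (invmx R_mx^T).
Definition rho_s : 'M[int]_(5 + 5) := block_mx S0_mx 0 0 S0_mx^T.

(* The symplectic representation induced by the action is [r |-> rho_r],
   [s |-> rho_s] in the basis [c]. *)
Definition acts_by_rho (R : realType) (S : riemann_surface R)
    (c : 'I_(5 + 5) -> R -> S) (r s : S -> S) :=
  coordinates c (fun j => r \o c j) rho_r /\
  coordinates c (fun j => s \o c j) rho_s.

Definition Z_uvw (R : realType) (u v w : Cplx R) : 'M[Cplx R]_5 := mx_of_rows 5
  [:: [:: 2 * (u + v + w); - w - u; - (2 * v); - v - w - u; - v + u];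
      [:: - w - u; - v + w / 2 + 5 / 4 * u; v - u / 2; w + u / 2; v - u];
      [:: - (2 * v); v - u / 2; u; v; w];
      [:: - v - w - u; w + u / 2; v; u; - w];
      [:: - v + u; v - u; w; - w; 2 * (u - v - w)]].

(* Main.v *)
Require Import Defs.
From HB Require Import structures.
From mathcomp Require Import all_boot all_order all_algebra.
From mathcomp Require Import all_classical all_reals all_analysis.
From mathcomp Require Import complex freeg ring lra.

Set Implicit Arguments.
Unset Strict Implicit.
Unset Printing Implicit Defensive.

Import Order.TTheory GRing.Theory Num.Theory.
Import numFieldNormedType.Exports.

Local Open Scope classical_set_scope.
Local Open Scope complex_scope.
Local Open Scope ring_scope.

(* The automorphism r pulls holomorphic 1-forms back to holomorphic 1-forms, and
   the periods of r^* w over the basis c are the periods of w over r(c).  If N is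
   the symplectic matrix of the change of basis from d to c, this shows that
   N rho(r) N^-1 is the rational representation of an endomorphism of JS.  Hence
   it is also one of every member Z of the Shimura family, which after the change
   of basis says that Z' = N.Z satisfies R Z' R^t = Z'.  Together with the
   symmetry of Z', these linear equations leave exactly three free parameters,
   the entries u, v, w of the third row of Z'.

   The analytic facts behind the first sentence are obtained from Goursat's
   subdivision argument, applied directly to C^1 singular triangles in the
   surface: the form is approximated near a point by an exact one, using only
   complex differentiability at that point.  This gives the invariance of
   periods under homology, as well as Cauchy's formula (by contracting a circle),
   hence the holomorphy of the derivative of a holomorphic map, which the
   pullback of a form involves. *)

(** * Complex derivatives *)

(** Two definitions shape the analysis. Holomorphy means bare complex differentiability, so a
    derivative is not known to be continuous: Green's formula is out of reach, and the pullback of a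
    form, whose coefficient contains the derivative of [r], is not visibly holomorphic. Homology is
    generated by boundaries of C^1 maps from the plane, which may be degenerate and need not stay in
    one chart, so the subdivision takes place in the parameter plane. Goursat's argument is
    therefore carried out for an abstract function [G] of a vector and a point; it serves both for
    triangles in the surface and for the homotopy of circles behind Cauchy's formula.

    On the algebraic side, write (X Y) for (I Z) N. The relation A (X Y) = (X Y) diag(R, R^-t) reads
    A X = X R and A Y = Y R^-t, and eliminating A requires X to be invertible. This follows from Im
    Z > 0 through Riemann's bilinear relations, which also place Z' = X^-1 Y in the Siegel space.
    The resulting equation R Z' = Z' R^-t is linear and is solved entry by entry. *)

Section Modulus.
Variable R : realType.
Local Notation C := (Cplx R).

(** The norm of [C] takes its values in [C]; a real-valued version makes the estimates accessible to
    [lra]. *)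
Definition modulus (z : C) : R := Normc.normc z.

Arguments modulus : simpl never.

Lemma normE (z : C) : `|z| = (modulus z)%:C :> C.
Proof. by case: z. Qed.

Lemma modulus0 : modulus 0 = 0. Proof. exact: Normc.normc0. Qed.
Lemma modulus1 : modulus 1 = 1. Proof. exact: Normc.normc1. Qed.
Lemma modulusM (x y : C) : modulus (x * y) = modulus x * modulus y.
Proof. exact: Normc.normcM. Qed.
Lemma modulusV (x : C) : modulus x^-1 = (modulus x)^-1.
Proof. exact: Normc.normcV. Qed.
Lemma modulusD (x y : C) : modulus (x + y) <= modulus x + modulus y.
Proof. exact: le_normcD. Qed.
Lemma modulusN (x : C) : modulus (- x) = modulus x.
Proof. exact: normcN. Qed.
Lemma modulusX (x : C) n : modulus (x ^+ n) = modulus x ^+ n.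
Proof.
by elim: n => [|n IH]; rewrite ?expr0 ?modulus1// !exprS modulusM IH.
Qed.
Lemma modulus_ge0 (x : C) : 0 <= modulus x.
Proof. by case: x => a b; rewrite /modulus /= sqrtr_ge0. Qed.
Lemma modulus_eq0 (x : C) : (modulus x == 0) = (x == 0).
Proof.
apply/eqP/eqP => [|->]; [exact: Normc.eq0_normc|exact: modulus0].
Qed.
Lemma modulus_gt0 (x : C) : (0 < modulus x) = (x != 0).
Proof. by rewrite lt0r modulus_ge0 andbT modulus_eq0. Qed.

Lemma modulus_real (x : R) : modulus x%:C = `|x|.
Proof. by rewrite /modulus /= expr0n /= addr0 sqrtr_sqr. Qed.

Lemma ler_modulusB (x y : C) : modulus x - modulus y <= modulus (x - y).
Proof. by rewrite lerBlDr (le_trans _ (modulusD _ _)) ?subrK. Qed.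

Lemma Re_le_modulus (x : C) : `|complex.Re x| <= modulus x.
Proof.
case: x => a b; rewrite /modulus /= -sqrtr_sqr ler_sqrt ?lerDl ?sqr_ge0//.
by rewrite addr_ge0 ?sqr_ge0.
Qed.

Lemma Im_le_modulus (x : C) : `|complex.Im x| <= modulus x.
Proof.
case: x => a b; rewrite /modulus /= -sqrtr_sqr ler_sqrt ?lerDr ?sqr_ge0//.
by rewrite addr_ge0 ?sqr_ge0.
Qed.

Lemma modulus_le_ReIm (x : C) :
  modulus x <= `|complex.Re x| + `|complex.Im x|.
Proof.
case: x => a b; rewrite /modulus /=.
have ab0 : 0 <= `|a| + `|b| by rewrite addr_ge0.
rewrite -[leRHS]ger0_norm// -[leRHS]sqrtr_sqr ler_sqrt ?sqr_ge0//.
rewrite sqrrD !real_normK ?num_real// addrAC lerDl mulrn_wge0 ?mulr_ge0//.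
Qed.

Lemma nbhs_modulus (z : C) (A : set C) :
  nbhs z A <-> exists2 d : R, 0 < d & forall w, modulus (w - z) < d -> A w.
Proof.
split=> [/nbhs_ballP[e /= e0 eA]|[d d0 dA]].
  have er : e = (complex.Re e)%:C by case: e e0 {eA} => a b /andP[/eqP /= ->].
  exists (complex.Re e); first by rewrite -ltcR -er.
  move=> w wz; apply: eA; rewrite -ball_normE /= distrC normE er ltcR.
  exact: wz.
apply/nbhs_ballP; exists d%:C => /=; first by rewrite ltcR.
move=> w; rewrite -ball_normE /= distrC normE ltcR; exact: dA.
Qed.

Lemma near_modulus (z : C) (P : C -> Prop) :
  (\forall w \near z, P w) <->
  exists2 d : R, 0 < d & forall w, modulus (w - z) < d -> P w.
Proof. exact: nbhs_modulus. Qed.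

Lemma cvg_modulus T (F : set_system T) (f : T -> C) (l : C) : Filter F ->
  f @ F --> l <->
  forall e : R, 0 < e -> \forall t \near F, modulus (f t - l) < e.
Proof.
move=> FF; split=> [fl e e0|fl A /nbhs_modulus[e e0 eA]].
  by apply: (fl [set w | modulus (w - l) < e]); apply/nbhs_modulus; exists e.
by apply: filterS (fl _ e0) => t; exact: eA.
Qed.

Lemma cvg_complex T (F : set_system T) (f : T -> C) (l : C) : Filter F ->
  f @ F --> l <->
  (fun t => complex.Re (f t)) @ F --> complex.Re l /\
  (fun t => complex.Im (f t)) @ F --> complex.Im l.
Proof.
move=> FF; split=> [/cvg_modulus fl|[/cvgrPdist_lt fr /cvgrPdist_lt fi]].
  split; apply/cvgrPdist_lt => e e0; apply: filterS (fl _ e0) => t.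
    by apply: le_lt_trans; rewrite distrC; have := Re_le_modulus (f t - l);
       rewrite raddfB.
  by apply: le_lt_trans; rewrite distrC; have := Im_le_modulus (f t - l);
     rewrite raddfB.
apply/cvg_modulus => e e0; have e20 : 0 < e / 2 by rewrite divr_gt0.
apply: filterS2 (fr _ e20) (fi _ e20) => t tr ti.
apply: le_lt_trans (modulus_le_ReIm _) _.
rewrite !raddfB /= -[X in X + _]distrC [`|complex.Im _ - _|]distrC; lra.
Qed.

End Modulus.

Arguments modulus {R} z : simpl never.

Section DifferenceQuotient.
Variable K : numFieldType.

(** Multiplying the difference quotient by [h] makes the case [h = 0] trivial, so the punctured
    neighbourhood becomes a full one. The lemma is used over both [R] and [C]. *)
Lemma derive1P (f : K -> K) (z l : K) :
  derivable f z 1 /\ derive1 f z = l <->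
  forall e, 0 < e ->
    \forall h \near 0, `|f (z + h) - f z - l * h| <= e * `|h|.
Proof.
have E h : h != 0 ->
    f (z + h) - f z - l * h = - (l - h^-1 *: (f (h *: 1 + z) - f z)) * h.
  move=> h0; rewrite /GRing.scale /= mulr1 [z + h]addrC opprB mulrBl mulrAC.
  by rewrite mulVf// mul1r.
split=> [[df fl] e e0|H].
  have cl : h^-1 *: ((f \o shift z) (h *: 1) - f z) @[h --> 0^'] --> l.
    by rewrite -fl derive1E; exact: df.
  move/cvgrPdist_le : cl => /(_ e e0).
  rewrite near_withinE; apply: filterS => h hl.
  have [->|h0] := eqVneq h 0; first by rewrite addr0 mulr0 subrr subr0 normr0 mulr0.
  by rewrite E// normrM normrN ler_wpM2r// hl.
have cl : h^-1 *: ((f \o shift z) (h *: 1) - f z) @[h --> 0^'] --> l.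
  apply/cvgrPdist_le => e e0; rewrite near_withinE.
  apply: filterS (H e e0) => h hl /= h0.
  by move: hl; rewrite E// normrM normrN ler_pM2r ?normr_gt0.
split; first by apply/cvg_ex; exists l.
by rewrite derive1E; exact/cvg_lim.
Qed.

End DifferenceQuotient.

Section Derivative.
Variable R : realType.
Local Notation C := (Cplx R).

(* [phi] is the inclusion of the domain into C: the identity of C for complex
   derivatives, the inclusion of R for the velocity of a curve. *)
Definition has_deriv (E : zmodType) (phi : {additive E -> C}) (f : E -> C)
    (z : E) (l : C) :=
  forall e : R, 0 < e -> exists2 d : R, 0 < d & forall h, modulus (phi h) < d ->
    modulus (f (z + h) - f z - l * phi h) <= e * modulus (phi h).

Definition cderiv : (C -> C) -> C -> C -> Prop :=
  has_deriv (idfun : {additive C -> C}).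
Definition vderiv : (R -> C) -> R -> C -> Prop :=
  has_deriv (real_complex R : {additive R -> C}).

Section Rules.
Variables (E : zmodType) (phi : {additive E -> C}).
Implicit Types (f g : E -> C) (z : E) (l m : C).

(** Allows a constant factor in the error, so that sums, products and compositions need no prior
    division of the tolerance. *)
Lemma has_derivI (K : R) f z l :
  (forall e : R, 0 < e -> e <= 1 -> exists2 d : R, 0 < d &
     forall h, modulus (phi h) < d ->
       modulus (f (z + h) - f z - l * phi h) <= K * e * modulus (phi h)) ->
  has_deriv phi f z l.
Proof.
move=> H e e0; have K0 : 0 < `|K| + 1 by rewrite ltr_wpDl.
have m0 : 0 < Num.min 1 (e / (`|K| + 1)) by rewrite lt_min ltr01 divr_gt0.
have [|d d0 hd] := H _ m0; first by rewrite ge_min lexx.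
exists d => // h /hd/le_trans; apply; apply: ler_wpM2r; first exact: modulus_ge0.
apply: (@le_trans _ _ ((`|K| + 1) * Num.min 1 (e / (`|K| + 1)))).
  by rewrite ler_wpM2r ?(ltW m0)// ler_wpDr// ler_norm.
by rewrite mulrC -ler_pdivlMr// ge_min lexx orbT.
Qed.

Lemma has_deriv_lip f z l : has_deriv phi f z l ->
  exists2 d : R, 0 < d & forall h, modulus (phi h) < d ->
    modulus (f (z + h) - f z) <= (modulus l + 1) * modulus (phi h).
Proof.
move=> /(_ 1 ltr01)[d d0 H]; exists d => // h /H; rewrite mul1r => {}H.
have -> : f (z + h) - f z = (f (z + h) - f z - l * phi h) + l * phi h.
  by rewrite subrK.
by rewrite (le_trans (modulusD _ _))// modulusM mulrDl mul1r addrC lerD.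
Qed.

Lemma has_deriv_cont f z l : has_deriv phi f z l ->
  forall e : R, 0 < e -> exists2 d : R, 0 < d &
    forall h, modulus (phi h) < d -> modulus (f (z + h) - f z) < e.
Proof.
move=> /has_deriv_lip[d d0 H] e e0.
have l0 : 0 < modulus l + 1 by rewrite ltr_wpDl// modulus_ge0.
exists (Num.min d (e / (modulus l + 1))); first by rewrite lt_min d0 divr_gt0.
move=> h; rewrite lt_min => /andP[/H/le_lt_trans hd he]; apply: hd.
by rewrite mulrC -ltr_pdivlMr.
Qed.

Lemma has_deriv_near f g z l (d : R) : 0 < d ->
  (forall h, modulus (phi h) < d -> f (z + h) = g (z + h)) ->
  has_deriv phi f z l -> has_deriv phi g z l.
Proof.
move=> d0 fg H e /H[d' d'0 {}H]; exists (Num.min d d'); first by rewrite lt_min d0.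
move=> h; rewrite lt_min => /andP[hd /H].
have <- : f z = g z by rewrite -(addr0 z) fg// raddf0 modulus0.
by rewrite fg.
Qed.

Lemma has_deriv_eq f g z l : f =1 g -> has_deriv phi f z l -> has_deriv phi g z l.
Proof. by move=> fg; apply: (has_deriv_near ltr01) => h _; exact: fg. Qed.

Lemma has_deriv_cst (a : C) z : has_deriv phi (fun=> a) z 0.
Proof.
move=> e e0; exists 1 => // h _.
by rewrite subrr mul0r subr0 modulus0 mulr_ge0// ?modulus_ge0// ltW.
Qed.

Lemma has_deriv_incl z : has_deriv phi phi z 1.
Proof.
move=> e e0; exists 1 => // h _; rewrite raddfD mul1r [_ + phi h]addrC addrK subrr.
by rewrite modulus0 mulr_ge0// ?modulus_ge0// ltW.
Qed.

Lemma has_derivD f g z l m : has_deriv phi f z l -> has_deriv phi g z m ->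
  has_deriv phi (fun x => f x + g x) z (l + m).
Proof.
move=> Hf Hg; apply: (@has_derivI 2) => e e0 _.
have [d1 d10 {}Hf] := Hf e e0; have [d2 d20 {}Hg] := Hg e e0.
exists (Num.min d1 d2) => [|h]; first by rewrite lt_min d10.
rewrite lt_min => /andP[/Hf h1 /Hg h2].
have -> : f (z + h) + g (z + h) - (f z + g z) - (l + m) * phi h =
  (f (z + h) - f z - l * phi h) + (g (z + h) - g z - m * phi h) by ring.
rewrite (le_trans (modulusD _ _))// -mulrA mulr_natl mulr2n; exact: lerD.
Qed.

Lemma has_derivM f g z l m : has_deriv phi f z l -> has_deriv phi g z m ->
  has_deriv phi (fun x => f x * g x) z (l * g z + f z * m).
Proof.
move=> Hf Hg.
apply: (@has_derivI ((modulus l + 1) + modulus (g z) + modulus (f z))) => e e0 _.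
have [d1 d10 hf] := Hf e e0; have [d2 d20 hg] := Hg e e0.
have [d3 d30 hl] := has_deriv_lip Hf; have [d4 d40 hc] := has_deriv_cont Hg e0.
exists (Num.min (Num.min d1 d2) (Num.min d3 d4)) => [|h].
  by rewrite !lt_min d10 d20 d30 d40.
rewrite !lt_min => /andP[/andP[/hf h1 /hg h2] /andP[/hl h3 /hc h4]].
have -> : f (z + h) * g (z + h) - f z * g z - (l * g z + f z * m) * phi h =
  (f (z + h) - f z) * (g (z + h) - g z) +
  ((f (z + h) - f z - l * phi h) * g z +
    f z * (g (z + h) - g z - m * phi h)) by ring.
rewrite (le_trans (modulusD _ _))//.
rewrite [leRHS](_ : _ = (modulus l + 1) * modulus (phi h) * e +
  (e * modulus (phi h) * modulus (g z) +
   modulus (f z) * (e * modulus (phi h)))); last by ring.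
apply: lerD.
  by rewrite modulusM; apply: ler_pM; rewrite ?modulus_ge0 ?(ltW h4).
rewrite (le_trans (modulusD _ _))// !modulusM.
by apply: lerD; [apply: ler_wpM2r|apply: ler_wpM2l]; rewrite ?modulus_ge0.
Qed.

Lemma has_derivZ (a : C) f z l : has_deriv phi f z l ->
  has_deriv phi (fun x => a * f x) z (a * l).
Proof. by move=> /(has_derivM (has_deriv_cst a z)); rewrite mul0r add0r. Qed.

Lemma has_derivN f z l : has_deriv phi f z l ->
  has_deriv phi (fun x => - f x) z (- l).
Proof.
move=> /(has_derivZ (-1)); rewrite mulN1r; apply: has_deriv_eq => x.
by rewrite mulN1r.
Qed.

Lemma has_derivB f g z l m : has_deriv phi f z l -> has_deriv phi g z m ->
  has_deriv phi (fun x => f x - g x) z (l - m).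
Proof. by move=> Hf /has_derivN; exact: has_derivD. Qed.

Lemma has_deriv_comp (f : C -> C) g z l m :
  has_deriv phi g z l -> cderiv f (g z) m ->
  has_deriv phi (fun x => f (g x)) z (m * l).
Proof.
move=> Hg Hf; apply: (@has_derivI ((modulus l + 1) + modulus m)) => e e0 _.
have [d1 d10 hf] := Hf e e0; have [d2 d20 hg] := Hg e e0.
have [d3 d30 hl] := has_deriv_lip Hg; have [d4 d40 hc] := has_deriv_cont Hg d10.
exists (Num.min d2 (Num.min d3 d4)) => [|h]; first by rewrite !lt_min d20 d30 d40.
rewrite !lt_min => /andP[/hg h2 /andP[/hl h3 /hc h4]].
have /= := hf _ h4; rewrite [g z + _]addrC subrK => h5.
have -> : f (g (z + h)) - f (g z) - m * l * phi h =
  (f (g (z + h)) - f (g z) - m * (g (z + h) - g z)) +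
  m * (g (z + h) - g z - l * phi h) by ring.
rewrite (le_trans (modulusD _ _))// !mulrDl modulusM -!mulrDl; apply: (@le_trans _ _
  (e * ((modulus l + 1) * modulus (phi h)) + modulus m * (e * modulus (phi h)))).
  apply: lerD; last by rewrite ler_wpM2l ?modulus_ge0.
  by apply: (le_trans h5); rewrite ler_wpM2l ?(ltW e0).
by rewrite le_eqVlt; apply/orP; left; apply/eqP; ring.
Qed.

Lemma has_deriv_uniq f z l m :
  (forall d : R, 0 < d -> exists2 h, phi h != 0 & modulus (phi h) < d) ->
  has_deriv phi f z l -> has_deriv phi f z m -> l = m.
Proof.
move=> nz Hl Hm; apply/eqP; rewrite -subr_eq0 -modulus_eq0 eq_le modulus_ge0.
rewrite andbT; apply/ler_addgt0Pl => e e0; rewrite addr0.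
have e20 : 0 < e / 2 by rewrite divr_gt0.
have [d1 d10 {}Hl] := Hl _ e20; have [d2 d20 {}Hm] := Hm _ e20.
have d0 : 0 < Num.min d1 d2 by rewrite lt_min d10.
have [h h0] := nz _ d0; rewrite lt_min => /andP[/Hl h1 /Hm h2].
have hp : 0 < modulus (phi h) by rewrite modulus_gt0.
rewrite -(ler_pM2r hp) -modulusM.
have -> : (l - m) * phi h = (f (z + h) - f z - m * phi h)
  + - (f (z + h) - f z - l * phi h) by ring.
rewrite (le_trans (modulusD _ _))// modulusN; lra.
Qed.

End Rules.

Lemma cderiv_id (z : C) : cderiv id z 1.
Proof. exact: has_deriv_incl. Qed.

(** The remainder is exactly h^2 / (z^2 (z + h)), and |z + h| >= |z| / 2 for small [h]; this gives
    the constant 2 / |z|^3. *)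
Lemma cderiv_inv (z : C) : z != 0 -> cderiv (fun x => x^-1) z (- (z ^+ 2)^-1).
Proof.
move=> z0; have mz : 0 < modulus z by rewrite modulus_gt0.
apply: (@has_derivI _ _ (2 / modulus z ^+ 3)) => e e0 e1.
exists (Num.min e (modulus z / 2)) => [|h]; first by rewrite lt_min e0 divr_gt0.
rewrite lt_min => /andP[/= he hz].
have zh : modulus z / 2 <= modulus (z + h).
  have := ler_modulusB z (- h); rewrite modulusN opprK; lra.
have zh0 : z + h != 0 by rewrite -modulus_gt0 (lt_le_trans _ zh)// divr_gt0.
have -> : (z + h)^-1 - z^-1 - - (z ^+ 2)^-1 * h =
  h * h * (z ^+ 2)^-1 * (z + h)^-1 by field; rewrite zh0.
rewrite !modulusM !modulusV modulusX mulrAC.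
have -> : 2 / modulus z ^+ 3 * e * modulus h =
  e * (modulus h * (modulus z ^- 2 * (modulus z / 2)^-1)).
  by field; rewrite gt_eqF.
rewrite -2!mulrA; apply: ler_pM; rewrite ?modulus_ge0 ?(ltW he)//.
  by rewrite !mulr_ge0 ?invr_ge0 ?modulus_ge0// exprn_ge0 ?modulus_ge0.
rewrite ler_wpM2l ?modulus_ge0// [leLHS]mulrC.
rewrite ler_wpM2l ?invr_ge0 ?exprn_ge0 ?modulus_ge0//.
by rewrite lef_pV2 ?posrE// ?divr_gt0// (lt_le_trans _ zh)// divr_gt0.
Qed.

Lemma cderivE (f : C -> C) (z l : C) : cderiv f z l <->
  forall e : R, 0 < e -> exists2 d : R, 0 < d & forall h : C, modulus h < d ->
    modulus (f (z + h) - f z - l * h) <= e * modulus h.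
Proof. by []. Qed.

Lemma vderivE (k : R -> C) (t : R) (l : C) : vderiv k t l <->
  forall e : R, 0 < e -> exists2 d : R, 0 < d & forall h : R, `|h| < d ->
    modulus (k (t + h) - k t - l * h%:C) <= e * `|h|.
Proof.
by split=> H e /H[d d0 {}H]; exists d => // h; have := H h; rewrite modulus_real.
Qed.

Lemma cderivP (f : C -> C) (z l : C) :
  cderiv f z l <-> derivable f z 1 /\ derive1 f z = l.
Proof.
rewrite derive1P; split=> [H e e0|H e e0].
  (* A positive element of [C] is real. *)
  have [r er] : exists r : R, e = r%:C.
    by exists (complex.Re e); case: e e0 => a b /andP[/eqP /= ->].
  move: e0; rewrite er ltcR => /H[d d0 {}H]; apply/near_modulus; exists d => // h.
  by rewrite subr0 => /H; rewrite !normE -rmorphM lecR.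
have /H/near_modulus[d d0 {}H] : 0 < e%:C :> C by rewrite ltcR.
exists d => // h hd; have := H h; rewrite subr0 => /(_ hd).
by rewrite !normE -rmorphM lecR.
Qed.

Lemma near0_norm (P : R -> Prop) : (\forall h \near 0, P h) <->
  exists2 d : R, 0 < d & forall h, `|h| < d -> P h.
Proof.
split=> [/nbhs_ballP[d d0 H]|[d d0 H]].
  by exists d => // h hd; apply: H; rewrite -ball_normE /= sub0r normrN.
by apply/nbhs_ballP; exists d => //= h; rewrite -ball_normE /= sub0r normrN => /H.
Qed.

Lemma vderivP (k : R -> C) (t : R) (l : C) :
  vderiv k t l <->
  [/\ derivable (fun u => complex.Re (k u)) t 1,
      derivable (fun u => complex.Im (k u)) t 1 &
      derive1 (fun u => complex.Re (k u)) t +i*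
      derive1 (fun u => complex.Im (k u)) t = l].
Proof.
split=> [H|[dr di <-]].
  have [dr rl] : derivable (fun u => complex.Re (k u)) t 1 /\
      derive1 (fun u => complex.Re (k u)) t = complex.Re l.
    apply/derive1P => e /H[d d0 {}H]; apply/near0_norm; exists d => // h.
    have := H h; rewrite !modulus_real => /[apply]; apply: le_trans.
    apply: le_trans (Re_le_modulus _); rewrite !raddfB /=.
    by case: (l) => a b /=; rewrite mulr0 subr0.
  have [di il] : derivable (fun u => complex.Im (k u)) t 1 /\
      derive1 (fun u => complex.Im (k u)) t = complex.Im l.
    apply/derive1P => e /H[d d0 {}H]; apply/near0_norm; exists d => // h.
    have := H h; rewrite !modulus_real => /[apply]; apply: le_trans.
    apply: le_trans (Im_le_modulus _); rewrite !raddfB /=.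
    by case: (l) => a b /=; rewrite mulr0 add0r.
  by split=> //; rewrite rl il; case: (l).
apply: (@has_derivI _ _ 2) => e e0 _.
have /near0_norm[d1 d10 h1] := (derive1P _ _ _).1 (conj dr erefl) e e0.
have /near0_norm[d2 d20 h2] := (derive1P _ _ _).1 (conj di erefl) e e0.
exists (Num.min d1 d2) => [|h]; first by rewrite lt_min d10.
rewrite !modulus_real lt_min => /andP[/h1 {}h1 /h2 {}h2].
rewrite (le_trans (modulus_le_ReIm _))// -mulrA mulr_natl mulr2n; apply: lerD.
  by rewrite !raddfB /= mulr0 !oppr0 addr0.
by rewrite !raddfB /= mulr0 add0r.
Qed.

Lemma real_complex_small (d : R) : 0 < d ->
  exists2 h : R, h%:C != 0 :> C & modulus (h%:C : C) < d.
Proof.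
move=> d0; exists (d / 2).
  by rewrite -modulus_gt0 modulus_real gtr0_norm ?divr_gt0.
by rewrite modulus_real gtr0_norm ?divr_gt0//; lra.
Qed.

Lemma vderiv_uniq k t l m : vderiv k t l -> vderiv k t m -> l = m.
Proof. apply: has_deriv_uniq; exact: real_complex_small. Qed.

End Derivative.

(** * Integrals of continuous complex functions *)

Section RealIntegral.
Variable R : realType.
Implicit Types f F : R -> R.
Local Notation mu := (@lebesgue_measure R).

Lemma continuous_integrable f a b : continuous f ->
  mu.-integrable `[a, b] (EFin \o f).
Proof.
move=> cf; apply: continuous_compact_integrable; first exact: segment_compact.
exact: continuous_subspaceT.
Qed.

Lemma Rintegral_FTC2 f F a b : a < b -> continuous f ->
  (forall t, a <= t <= b -> derivable F t 1 /\ derive1 F t = f t) ->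
  \int[mu]_(t in `[a, b]) f t = F b - F a.
Proof.
move=> ab cf dF; rewrite /Rintegral.
have cF t : a <= t <= b -> {for t, continuous F}.
  by move=> /dF[/derivable1_diffP/differentiable_continuous].
rewrite (@continuous_FTC2 _ f F a b)//.
- exact: continuous_subspaceT.
- split; first by move=> t /andP[/= ta tb]; have [] := dF t; rewrite ?(ltW ta) ?(ltW tb).
  + by apply: cvg_at_right_filter; apply: cF; rewrite lexx ltW.
  + by apply: cvg_at_left_filter; apply: cF; rewrite lexx ltW.
- by move=> t /andP[/= ta tb]; have [] := dF t; rewrite ?(ltW ta) ?(ltW tb).
Qed.

Lemma continuous_primitive f a b : continuous f ->
  exists F : R -> R, forall t, a < t < b -> derivable F t 1 /\ derive1 F t = f t.
Proof.
move=> cf; exists (fun x => \int[mu]_(t in `[a, x]) f t) => t /andP[at_ tb].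
exact: (continuous_FTC1_closed tb (continuous_integrable _ _ cf) at_ (cf t)).
Qed.

End RealIntegral.

Section ComplexIntegral.
Variable R : realType.
Local Notation C := (Cplx R).
Implicit Types F G P : R -> C.
Local Notation mu := (@lebesgue_measure R).

Definition cint F : C :=
  (\int[mu]_(t in `[0, 1]) complex.Re (F t)) +i*
  (\int[mu]_(t in `[0, 1]) complex.Im (F t)).

Arguments cint : simpl never.

Lemma continuous_Re F : continuous F -> continuous (fun t => complex.Re (F t)).
Proof. by move=> cF t; have /cvg_complex[] := cF t. Qed.

Lemma continuous_Im F : continuous F -> continuous (fun t => complex.Im (F t)).
Proof. by move=> cF t; have /cvg_complex[] := cF t. Qed.

Lemma eq_cint F G : (forall t : R, 0 <= t <= 1 -> F t = G t) -> cint F = cint G.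
Proof.
by move=> FG; congr (_ +i* _); apply: eq_Rintegral => t;
  rewrite inE /= in_itv /= => /FG ->.
Qed.

Lemma cint_FTC F P : continuous F ->
  (forall t : R, 0 <= t <= 1 -> vderiv P t (F t)) -> cint F = P 1 - P 0.
Proof.
move=> cF dP; rewrite /cint.
have dr t : 0 <= t <= 1 -> derivable (fun u : R => complex.Re (P u)) t 1 /\
    derive1 (fun u : R => complex.Re (P u)) t = complex.Re (F t).
  by move=> /dP/vderivP[dr di <-]; split; [exact: dr|].
have di t : 0 <= t <= 1 -> derivable (fun u : R => complex.Im (P u)) t 1 /\
    derive1 (fun u : R => complex.Im (P u)) t = complex.Im (F t).
  by move=> /dP/vderivP[_ di <-]; split; [exact: di|].
rewrite (Rintegral_FTC2 ltr01 (continuous_Re cF) dr).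
rewrite (Rintegral_FTC2 ltr01 (continuous_Im cF) di).
by rewrite -!raddfB; case: (P 1 - P 0).
Qed.

(** Together with [cint_FTC], this turns splitting, reversal and linearity of the integral into
    computations of derivatives. *)
Lemma cprimitive F : continuous F ->
  exists P, forall t : R, 0 <= t <= 1 -> vderiv P t (F t).
Proof.
move=> cF.
(* Primitives are differentiable only inside their interval; enlarging [[0, 1]] provides two-sided
   derivatives at 0 and 1. *)
have [P1 H1] := continuous_primitive (-1) 2 (continuous_Re cF).
have [P2 H2] := continuous_primitive (-1) 2 (continuous_Im cF).
exists (fun t => P1 t +i* P2 t) => t /andP[t0 t1]; apply/vderivP.
have t12 : -1 < t < 2 by lra.
have [d1 e1] := H1 t t12; have [d2 e2] := H2 t t12.
split; [exact: d1|exact: d2|].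
by rewrite [X in X +i* _]e1 [X in _ +i* X]e2; case: (F t).
Qed.

Lemma continuous_affine F (k a : R) : continuous F ->
  continuous (fun t => F (k * t + a)).
Proof.
move=> cF t; apply: continuous_comp; last exact: cF.
by apply: cvgD; [apply: cvgM; [exact: cvg_cst|exact: cvg_id]|exact: cvg_cst].
Qed.

Lemma continuous_cmul (c : C) F : continuous F -> continuous (fun t => c * F t).
Proof. by move=> cF t; apply: cvgM; [exact: cvg_cst|exact: cF]. Qed.

Lemma vderiv_affine P (k a t : R) (l : C) : vderiv P (k * t + a) l ->
  vderiv (fun t => P (k * t + a)) t (k%:C * l).
Proof.
move=> /vderivE H; apply/vderivE => e e0; have k0 : 0 < `|k| + 1.
  by rewrite ltr_wpDl.
have [|d d0 {}H] := H (e / (`|k| + 1)); first by rewrite divr_gt0.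
exists (d / (`|k| + 1)) => [|h]; first by rewrite divr_gt0.
rewrite ltr_pdivlMr// => hd.
have khd : `|k * h| < d.
  by rewrite normrM (le_lt_trans _ hd)// mulrC ler_wpM2l// lerDl.
have := H _ khd.
rewrite (_ : k * t + a + k * h = k * (t + h) + a); last by ring.
rewrite (rmorphM (real_complex R)) mulrA [l * _]mulrC => /le_trans; apply.
rewrite normrM -mulrA ler_wpM2l ?(ltW e0)// mulrA ler_piMl//.
by rewrite mulrC ler_pdivrMr// mul1r lerDl.
Qed.

Lemma cint_affine F P (k a : R) : continuous F ->
  (forall t : R, 0 <= t <= 1 -> vderiv P (k * t + a) (F (k * t + a))) ->
  cint (fun t => k%:C * F (k * t + a)) = P (k + a) - P a.
Proof.
move=> cF dP; have c := continuous_cmul (c := k%:C) (continuous_affine (k := k) (a := a) cF).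
rewrite (cint_FTC (P := fun t => P (k * t + a)) c) ?mulr1 ?mulr0 ?add0r//.
by move=> t t01; apply: vderiv_affine; exact: dP.
Qed.

Lemma cint_split F : continuous F ->
  cint F = cint (fun t => (2^-1)%:C * F (2^-1 * t + 0))
         + cint (fun t => (2^-1)%:C * F (2^-1 * t + 2^-1)).
Proof.
move=> cF; have [P HP] := cprimitive cF; rewrite (cint_FTC cF HP).
rewrite (cint_affine (P := P) cF); last by move=> t /andP[t0 t1]; apply: HP; lra.
rewrite (cint_affine (P := P) cF); last by move=> t /andP[t0 t1]; apply: HP; lra.
rewrite addr0 (_ : 2^-1 + 2^-1 = 1 :> R); last by field.
by ring.
Qed.

Lemma cint_rev F : continuous F -> cint (fun t : R => F (1 - t)) = cint F.
Proof.
move=> cF; have [P HP] := cprimitive cF; rewrite (cint_FTC cF HP).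
have c := continuous_affine (k := -1) (a := 1) cF.
have E : (fun t : R => F (1 - t)) = fun t => F (-1 * t + 1).
  by apply/funext => t; congr F; ring.
rewrite E (cint_FTC (P := fun t => - P (-1 * t + 1)) c).
  by rewrite mulr1 mulr0 add0r addNr opprK addrC.
move=> t /andP[t0 t1]; have H1 : 0 <= -1 * t + 1 <= 1 by lra.
have /has_derivN := vderiv_affine (HP _ H1).
have -> : ((-1)%:C : C) = -1 by rewrite (rmorphN (real_complex R)) rmorph1.
by rewrite [-1 * F _]mulN1r opprK.
Qed.

Lemma cintD F G : continuous F -> continuous G ->
  cint (fun t => F t + G t) = cint F + cint G.
Proof.
move=> cF cG; have [P HP] := cprimitive cF; have [Q HQ] := cprimitive cG.
rewrite (cint_FTC cF HP) (cint_FTC cG HQ).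
have c : continuous (fun t => F t + G t).
  by move=> t; apply: cvgD; [exact: cF|exact: cG].
rewrite (cint_FTC (P := fun t => P t + Q t) c); first by ring.
by move=> t t01; apply: has_derivD; [exact: HP|exact: HQ].
Qed.

Lemma cintZ (c : C) F : continuous F -> cint (fun t => c * F t) = c * cint F.
Proof.
move=> cF; have [P HP] := cprimitive cF; rewrite (cint_FTC cF HP).
rewrite (cint_FTC (P := fun t => c * P t) (continuous_cmul cF)); first by ring.
by move=> t t01; apply: has_derivZ; exact: HP.
Qed.

Lemma cint0 : cint (fun=> 0) = 0.
Proof.
have c : continuous (fun _ : R => 0 : C) by move=> t; exact: cvg_cst.
rewrite (cint_FTC (P := fun=> 0) c) ?subr0// => t _; exact: has_deriv_cst.
Qed.

Lemma cint_sum n (F : 'I_n -> R -> C) (a : 'I_n -> C) :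
  (forall i, continuous (F i)) ->
  continuous (fun t => \sum_(i < n) a i * F i t) /\
  cint (fun t => \sum_(i < n) a i * F i t) = \sum_(i < n) a i * cint (F i).
Proof.
elim: n F a => [|n IH] F a cF.
  have -> : (fun t => \sum_(i < 0) a i * F i t) = fun=> 0.
    by apply/funext => t; rewrite big_ord0.
  by rewrite cint0 big_ord0; split=> // t; exact: cvg_cst.
have -> : (fun t => \sum_(i < n.+1) a i * F i t) = fun t =>
    (\sum_(i < n) a (widen_ord (leqnSn n) i) * F (widen_ord (leqnSn n) i) t) +
     a ord_max * F ord_max t.
  by apply/funext => t; rewrite big_ord_recr.
have [c E] := IH (fun i => F (widen_ord (leqnSn n) i))
  (fun i => a (widen_ord (leqnSn n) i)) (fun i => cF _).
have c' := continuous_cmul (c := a ord_max) (cF ord_max).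
split; first by move=> t; apply: cvgD; [exact: c|exact: c'].
by rewrite (cintD c c') E (cintZ _ (cF _)) big_ord_recr.
Qed.

(** The factor 2 comes from bounding the real and imaginary parts separately; it is harmless, since
    every use only needs some constant. *)
Lemma le_modulus_cint F (M : R) : continuous F ->
  (forall t : R, 0 <= t <= 1 -> modulus (F t) <= M) -> modulus (cint F) <= 2 * M.
Proof.
move=> cF FM.
have bd f : continuous f -> (forall t : R, 0 <= t <= 1 -> `|f t| <= M) ->
    `|\int[mu]_(t in `[0, 1]) f t| <= M.
  move=> cf fM.
  apply: le_trans (le_normr_Rintegral _ (continuous_integrable _ _ cf)) _ => //.
  have ci g : continuous g -> mu.-integrable `[0, 1] (EFin \o g).
    exact: continuous_integrable.
  apply: (@le_trans _ _ (\int[mu]_(t in `[0, 1]) cst M t)).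
    apply: le_Rintegral; first exact: measurable_itv.
    - by apply: (ci (fun t => `|f t|)) => t; apply: cvg_norm; exact: cf.
    - by apply: (ci (cst M)) => t; exact: cvg_cst.
    - by move=> t; rewrite /= in_itv /=; exact: fM.
  have E : mu `[0, 1] = 1%:E.
    by rewrite lebesgue_measure_itv /= lte_fin ltr01 oppr0 adde0.
  by rewrite Rintegral_cst// [X in fine X]E mulr1.
apply: le_trans (modulus_le_ReIm _) _; rewrite mulr_natl mulr2n.
apply: lerD; apply: bd => /=; [exact: continuous_Re| |exact: continuous_Im|].
  by move=> t /FM; apply: le_trans; exact: Re_le_modulus.
by move=> t /FM; apply: le_trans; exact: Im_le_modulus.
Qed.

Lemma cint_open F G : continuous F -> (forall t : R, 0 < t < 1 -> G t = F t) ->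
  (\int[mu]_(t in `]0, 1[) complex.Re (G t)) +i*
  (\int[mu]_(t in `]0, 1[) complex.Im (G t)) = cint F.
Proof.
move=> cF GF.
have E f g : continuous f -> (forall t : R, 0 < t < 1 -> g t = f t) ->
    \int[mu]_(t in `]0, 1[) g t = \int[mu]_(t in `[0, 1]) f t.
  move=> cf gf; have cI := @continuous_integrable _ _ 0 1 cf.
  rewrite -Rintegral_itv_obnd_cbnd; last first.
    by apply: integrableS cI => //; exact: subset_itv_oc_cc.
  rewrite -Rintegral_itv_bndo_bndc; last first.
    by apply: integrableS cI => //; exact: subset_itv_oo_cc.
  by apply: eq_Rintegral => t; rewrite inE /= in_itv /= => /gf.
by congr (_ +i* _); apply: E => [|t /GF ->//]; [exact: continuous_Re|exact: continuous_Im].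
Qed.

End ComplexIntegral.

Arguments cint {R} F : simpl never.

(** * Goursat's lemma for singular triangles *)

Lemma pair_ext (S T : Type) (u v : S * T) : u.1 = v.1 -> u.2 = v.2 -> u = v.
Proof. by case: u v => [? ?] [? ?] /= -> ->. Qed.

Ltac vec_ring :=
  apply: pair_ext; rewrite /= /GRing.scale /=; field.

Section Goursat.
Variable R : realType.
Local Notation C := (Cplx R).
Local Notation V := (R * R)%type.

(** The real mean value theorem for each of the two components, whence the factor 2. *)
Lemma vderiv_mean (D D' : R -> C) (M : R) :
  (forall t : R, 0 <= t <= 1 -> vderiv D t (D' t)) ->
  (forall t : R, 0 <= t <= 1 -> modulus (D' t) <= M) ->
  modulus (D 1 - D 0) <= 2 * M.
Proof.
move=> dD DM.
have bd (f f' : R -> R) :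
    (forall t : R, 0 <= t <= 1 -> derivable f t 1 /\ derive1 f t = f' t) ->
    (forall t : R, 0 <= t <= 1 -> `|f' t| <= M) -> `|f 1 - f 0| <= M.
  move=> df fM; have [] := @MVT_segment R f f' 0 1 ler01.
  - move=> t; rewrite in_itv /= => /andP[t0 t1].
    have [|d <-] := df t; first by rewrite !ltW.
    by rewrite derive1E; apply: DeriveDef.
  - apply: continuous_in_subspaceT => t; rewrite inE /= in_itv /= => /df[d _].
    by apply/differentiable_continuous/derivable1_diffP.
  - by move=> t; rewrite in_itv /= => /fM fM' ->; rewrite subr0 mulr1.
apply: le_trans (modulus_le_ReIm _) _; rewrite mulr_natl mulr2n !raddfB.
apply: lerD.
  apply: (bd (fun t => complex.Re (D t)) (fun t => complex.Re (D' t))).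
    by move=> t /dD/vderivP[dr _ <-]; split; [exact: dr|].
  by move=> t /DM; apply: le_trans; exact: Re_le_modulus.
apply: (bd (fun t => complex.Im (D t)) (fun t => complex.Im (D' t))).
  by move=> t /dD/vderivP[_ di <-]; split; [exact: di|].
by move=> t /DM; apply: le_trans; exact: Im_le_modulus.
Qed.

(** The intervals of centre [x n] and radius 2 N / 2^n are nested: their left ends [y] increase,
    their right ends [z] decrease, and the supremum of the left ends lies in all of them. *)
Lemma geometric_limit (x : nat -> R) (N : R) :
  (forall n, `|x n.+1 - x n| <= N / 2 ^+ n) ->
  exists l : R, forall n, `|x n - l| <= 2 * N / 2 ^+ n.
Proof.
move=> H; pose y n := x n - 2 * N / 2 ^+ n; pose z n := x n + 2 * N / 2 ^+ n.
have N0 : 0 <= N by have := H 0; rewrite expr0 divr1; exact: le_trans.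
have E n : 2 * N / 2 ^+ n = N / 2 ^+ n + 2 * N / 2 ^+ n.+1.
  by rewrite exprS; field; rewrite expf_neq0.
have Hn n : - (N / 2 ^+ n) <= x n.+1 - x n <= N / 2 ^+ n.
  by rewrite -ler_norml.
have ym : {homo y : m n / (m <= n)%N >-> m <= n}.
  apply: homo_leq => [//|a b c|n]; first exact: le_trans.
  by rewrite /y; have := E n; have /andP[] := Hn n; lra.
have zm : {homo z : m n / (m <= n)%N >-> n <= m}.
  apply: homo_leq => [//|a b c|n]; first by move=> ab bc; exact: le_trans bc ab.
  by rewrite /z; have := E n; have /andP[] := Hn n; lra.
have yz m n : y m <= z n.
  apply: (@le_trans _ _ (y (maxn m n))); first by apply: ym; exact: leq_maxl.
  apply: (@le_trans _ _ (z (maxn m n))); last by apply: zm; exact: leq_maxr.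
  have : 0 <= 2 * N / 2 ^+ (maxn m n) by rewrite !mulr_ge0// invr_ge0 exprn_ge0.
  by rewrite /y /z; lra.
have hs : has_sup (range y).
  by split; [exists (y 0), 0%N|exists (z 0) => _ [n _ <-]; exact: yz].
exists (sup (range y)) => n.
have h1 : y n <= sup (range y) by apply: ub_le_sup; [case: hs|exists n].
have h2 : sup (range y) <= z n.
  by apply: ge_sup; [case: hs|move=> _ [m _ <-]; exact: yz].
by move: h1 h2; rewrite /y /z ler_norml => h1 h2; apply/andP; split; lra.
Qed.

Definition norm1 (v : V) : R := `|v.1| + `|v.2|.

Arguments norm1 : simpl never.

Lemma norm1D u v : norm1 (u + v) <= norm1 u + norm1 v.
Proof.
by rewrite /norm1 addrACA; apply: lerD; exact: ler_normD.
Qed.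

Lemma norm1Z k v : norm1 (k *: v) = `|k| * norm1 v.
Proof. by rewrite /norm1 /= !normrM mulrDr. Qed.

Definition ex : V := (1, 0).
Definition ey : V := (0, 1).
(** The three edge directions of the standard triangle. Restricting to them means that local bounds
    concern three vectors, with no uniformity over directions. *)
Definition unit_dir (v : V) := v = ex \/ v = ey \/ v = ey - ex.

Lemma norm1_unit_dir v : unit_dir v -> norm1 v <= 2.
Proof.
by rewrite /norm1 => -[->|[->|->]] /=;
  rewrite ?subr0 ?sub0r ?normrN ?normr0 ?normr1; lra.
Qed.

Lemma vderiv_line (P : V -> C) (a v : V) (h t : R) l :
  vderiv (fun s => P (a + t *: (h *: v) + s *: v)) 0 l ->
  vderiv (fun t => P (a + t *: (h *: v))) t (h%:C * l).
Proof.
move=> l1.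
have := @vderiv_affine _ (fun s => P (a + t *: (h *: v) + s *: v)) h (- h * t) t l.
rewrite mulNr subrr => /(_ l1); apply: has_deriv_eq => s; congr P.
by vec_ring.
Qed.

Lemma norm1_diag : norm1 (ex + ey) <= 2.
Proof. by rewrite /norm1 /= addr0 add0r !normr1; lra. Qed.

(** [G v y] is the value at the point [y], on the vector [v], of a 1-form on the plane. Homogeneity
    in [v] is what subdividing and reversing an edge call for. *)
Variable G : V -> V -> C.
Hypothesis G_continuous : forall v, continuous (G v).
Hypothesis G_homogeneous : forall (k : R) v y, G (k *: v) y = k%:C * G v y.

Definition edge (a v : V) : C := cint (fun t : R => G v (a + t *: v)).

Lemma edge_continuous u a v : continuous (fun t : R => G u (a + t *: v)).
Proof.
move=> t; apply: continuous_comp; last exact: G_continuous.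
by apply: cvgD; [exact: cvg_cst|apply: cvgZ; [exact: cvg_id|exact: cvg_cst]].
Qed.

Lemma edge_split a v : edge a (2 *: v) = edge a v + edge (a + v) v.
Proof.
have c : continuous (fun t : R => G (2 *: v) (a + t *: (2 *: v))).
  exact: edge_continuous.
rewrite /edge (cint_split c).
have E (k l : R) : k * l = 1 -> forall y, k%:C * G (l *: v) y = G v y.
  by move=> kl y; rewrite -G_homogeneous scalerA kl scale1r.
congr (_ + _); apply: eq_cint => t _; rewrite E ?mulVf//; congr (G v _).
  by rewrite scalerA addr0 mulrAC mulVf// mul1r.
by vec_ring.
Qed.

Lemma edge_rev a v : edge (a + v) (- v) = - edge a v.
Proof.
have c : continuous (fun t : R => G v (a + t *: v)) by exact: edge_continuous.
have c' : continuous (fun t : R => G v (a + (1 - t) *: v)).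
  rewrite (_ : (fun t => _) = fun t : R => G v ((a + v) + t *: (- v))).
    exact: edge_continuous.
  by apply/funext => t; congr (G v _); vec_ring.
rewrite /edge -(cint_rev c) -[RHS]mulN1r -(cintZ _ c').
apply: eq_cint => t _.
have -> : G (- v) (a + v + t *: - v) = -1 * G v (a + v + t *: - v).
  have := G_homogeneous (-1) v (a + v + t *: - v).
  by rewrite scaleN1r => ->; rewrite (rmorphN (real_complex R)) rmorph1.
by rewrite scalerBl scale1r scalerN addrA.
Qed.

Arguments edge : simpl never.

Definition triangle (a : V) (h : R) : C :=
  edge a (h *: ex) + edge (a + h *: ex) (h *: (ey - ex)) - edge a (h *: ey).

Arguments triangle : simpl never.

(** Subdivision by the midpoints of the edges. The central triangle is a point reflection of the
    others, hence the scale [- h] from the corner opposite to [a]; the inner edges cancel by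
    [edge_rev]. *)
Lemma triangle_split a h :
  triangle a (2 * h) = triangle a h + triangle (a + h *: ex) h +
    triangle (a + h *: ey) h + triangle (a + h *: (ex + ey)) (- h).
Proof.
rewrite /triangle -!scalerA !edge_split !scaleNr.
have -> : a + h *: (ex + ey) + - (h *: ex) = a + h *: ey.
  by rewrite scalerDr addrA addrAC addrK.
have -> : a + h *: (ex + ey) = (a + h *: ey) + h *: ex.
  by rewrite scalerDr addrA addrAC.
rewrite edge_rev.
have -> : a + h *: ey + h *: ex = (a + h *: ex) + h *: ey by rewrite addrAC.
rewrite edge_rev.
have -> : a + h *: ey = (a + h *: ex) + h *: (ey - ex).
  by vec_ring.
rewrite edge_rev.
have -> : a + 2 *: (h *: ex) = a + h *: ex + h *: ex.
  by rewrite scaler_nat mulr2n addrA.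
have -> : a + h *: ex + h *: ex + h *: (ey - ex) =
    a + h *: ex + h *: ey.
  by vec_ring.
by ring.
Qed.

Hypothesis G_exact : forall p (e : R), 0 < e ->
  exists2 d : R, 0 < d & exists P : V -> C, forall y v,
    norm1 (y - p) < d -> unit_dir v ->
    exists l, vderiv (fun t => P (y + t *: v)) 0 l /\
              modulus (G v y - l) <= e * norm1 (y - p).

(** [vderiv_mean] applied to the difference between a primitive of the integrand and [P] along the
    edge. [K] bounds the distance from [p] to every point of the edge; the coefficient 2 of [|h|]
    bounds the norm of an edge direction. *)
Lemma edge_estimate p (e : R) : 0 < e ->
  exists2 d : R, 0 < d & exists P : V -> C, forall a h v (K : R),
    norm1 (a - p) + 2 * `|h| <= K -> K < d -> unit_dir v ->
    modulus (edge a (h *: v) - (P (a + h *: v) - P a)) <= 2 * (`|h| * (e * K)).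
Proof.
move=> e0; have [d d0 [P HP]] := G_exact p e0.
exists d => //; exists P => a h v K aK Kd uv.
have near t : 0 <= t <= 1 -> norm1 (a + t *: (h *: v) - p) <= K.
  move=> /andP[t0 t1]; apply: le_trans aK.
  rewrite addrAC (le_trans (norm1D _ _))// lerD2l !norm1Z ger0_norm// mulrA.
  rewrite mulrC ler_pM// ?mulr_ge0// ?norm1_unit_dir// ?ler_piMl//.
  by rewrite /norm1 addr_ge0.
have cF : continuous (fun t : R => G (h *: v) (a + t *: (h *: v))).
  exact: edge_continuous.
have [Q HQ] := cprimitive cF.
have /choice[l Hl] : forall t, exists l, 0 <= t <= 1 ->
    vderiv (fun s => P (a + t *: (h *: v) + s *: v)) 0 l /\
    modulus (G v (a + t *: (h *: v)) - l) <= e * K.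
  move=> t; have [t01|] := pselect (0 <= t <= 1); last by exists 0.
  have [l [l1 l2]] := HP _ _ (le_lt_trans (near _ t01) Kd) uv.
  exists l => _; split=> //; apply: le_trans l2 _.
  by rewrite ler_wpM2l ?near// ltW.
rewrite /edge (cint_FTC cF HQ).
have -> : Q 1 - Q 0 - (P (a + h *: v) - P a) =
    (Q 1 - P (a + 1 *: (h *: v))) - (Q 0 - P (a + 0 *: (h *: v))).
  by rewrite scale1r scale0r addr0; ring.
apply: (@vderiv_mean (fun t => Q t - P (a + t *: (h *: v)))
  (fun t => h%:C * (G v (a + t *: (h *: v)) - l t))).
  move=> t t01; have [l1 _] := Hl _ t01.
  rewrite mulrBr; apply: has_derivB; first by rewrite -G_homogeneous; exact: HQ.
  exact: vderiv_line.
move=> t t01; have [_ l2] := Hl _ t01.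
by rewrite modulusM modulus_real ler_wpM2l.
Qed.

(** The increments of [P] telescope around the triangle, leaving three edge errors, so 6 = 3 * 2.
    The second edge starts within 2 |h| of [a] and has length at most 2 |h|, which explains 4
    |h|. *)
Lemma triangle_estimate p (e : R) : 0 < e ->
  exists2 d : R, 0 < d & forall a h (K : R),
    norm1 (a - p) + 4 * `|h| <= K -> K < d ->
    modulus (triangle a h) <= 6 * (`|h| * (e * K)).
Proof.
move=> /(@edge_estimate p)[d d0 [P HP]]; exists d => // a h K aK Kd.
have a1 : norm1 (a - p) + 2 * `|h| <= K by move: aK (normr_ge0 h); lra.
have a2 : norm1 (a + h *: ex - p) + 2 * `|h| <= K.
  have n1 : norm1 (h *: ex) <= 2 * `|h|.
    by rewrite norm1Z mulrC ler_wpM2r// norm1_unit_dir//; left.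
  have := norm1D (a - p) (h *: ex).
  by rewrite addrAC => n2; move: n1 n2 aK (normr_ge0 h); lra.
have h1 := HP a h ex K a1 Kd (or_introl erefl).
have h2 := HP _ h (ey - ex) K a2 Kd (or_intror (or_intror erefl)).
have h3 := HP a h ey K a1 Kd (or_intror (or_introl erefl)).
move: h2; rewrite (_ : a + h *: ex + h *: (ey - ex) = a + h *: ey); last first.
  by vec_ring.
set X := edge _ (h *: (ey - ex)) => h2; rewrite /triangle -/X.
have -> : edge a (h *: ex) + X - edge a (h *: ey) =
   (edge a (h *: ex) - (P (a + h *: ex) - P a)) +
   ((X - (P (a + h *: ey) - P (a + h *: ex))) +
   - (edge a (h *: ey) - (P (a + h *: ey) - P a))) by ring.
apply: le_trans (modulusD _ _) _.
have h3' := h3; rewrite -modulusN in h3'.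
by have := le_trans (modulusD _ _) (lerD h2 h3'); move: h1; lra.
Qed.

Lemma quarter_of_sum (x y z t w : R) : x <= y + z + t + w ->
  [\/ x <= 4 * y, x <= 4 * z, x <= 4 * t | x <= 4 * w].
Proof.
have [?|y4] := leP x (4 * y); first by constructor 1.
have [?|z4] := leP x (4 * z); first by constructor 2.
have [?|t4] := leP x (4 * t); first by constructor 3.
by move=> h; constructor 4; lra.
Qed.

(** Each subdivision halves the scale and keeps at least a quarter of the modulus. Near the limit
    point of the corners a triangle of scale k has integral o(k^2), which absorbs the factor 4^n. *)
Lemma goursat a h : triangle a h = 0.
Proof.
have step (x : V * R) : exists y : V * R,
    [/\ y.2 = x.2 / 2 \/ y.2 = - (x.2 / 2), norm1 (y.1 - x.1) <= `|x.2|
      & modulus (triangle x.1 x.2) <= 4 * modulus (triangle y.1 y.2)].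
  case: x => b k /=; pose m := k / 2.
  have km : k = 2 * m by rewrite /m mulrC divfK.
  have nk v : norm1 v <= 2 -> norm1 (m *: v) <= `|k|.
    move=> v2; rewrite norm1Z mulrC [in leRHS]km [`|2 * _|]normrM ger0_norm//.
    exact: ler_wpM2r.
  set T1 := triangle b m; set T2 := triangle (b + m *: ex) m.
  set T3 := triangle (b + m *: ey) m.
  set T4 := triangle (b + m *: (ex + ey)) (- m).
  have : modulus (triangle b k) <=
      modulus T1 + modulus T2 + modulus T3 + modulus T4.
    rewrite km triangle_split.
    rewrite (le_trans (modulusD _ _))// lerD2r.
    rewrite (le_trans (modulusD _ _))// lerD2r.
    by rewrite (le_trans (modulusD _ _)).
  move=> /quarter_of_sum[] hT.
  - by exists (b, m); split; rewrite //= ?subrr /norm1 ?normr0 ?addr0//; left.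
  - exists (b + m *: ex, m); split => //=; first by left.
    by rewrite addrC addKr nk// norm1_unit_dir//; left.
  - exists (b + m *: ey, m); split => //=; first by left.
    by rewrite addrC addKr nk// norm1_unit_dir//; right; left.
  - exists (b + m *: (ex + ey), - m); split => //=; first by right.
    by rewrite addrC addKr nk// norm1_diag.
have [f Hf] := choice step.
pose x n := iter n f (a, h).
have xS n : x n.+1 = f (x n) by [].
have hn n : `|(x n).2| = `|h| / 2 ^+ n.
  elim: n => [|n IH]; first by rewrite expr0 divr1.
  have [e _ _] := Hf (x n); rewrite xS.
  have -> : `|(f (x n)).2| = `|(x n).2| / 2.
    by case: e => ->; rewrite ?normrN normrM (ger0_norm (_ : 0 <= 2^-1)).
  by rewrite IH exprS invfM [2^-1 * _]mulrC mulrA.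
have Tn n : modulus (triangle a h) <=
    4 ^+ n * modulus (triangle (x n).1 (x n).2).
  elim: n => [|n IH]; first by rewrite expr0 mul1r.
  apply: le_trans IH _; rewrite exprSr -mulrA ler_wpM2l ?exprn_ge0//.
  by have [_ _] := Hf (x n).
have dn n : norm1 ((x n.+1).1 - (x n).1) <= `|h| / 2 ^+ n.
  by rewrite -hn; have [_] := Hf (x n).
have [l1 Hl1] : exists l : R, forall n, `|(x n).1.1 - l| <= 2 * `|h| / 2 ^+ n.
  apply: geometric_limit => n; apply: le_trans (dn n).
  by rewrite /norm1 /= lerDl.
have [l2 Hl2] : exists l : R, forall n, `|(x n).1.2 - l| <= 2 * `|h| / 2 ^+ n.
  apply: geometric_limit => n; apply: le_trans (dn n).
  by rewrite /norm1 /= lerDr.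
apply/eqP; rewrite -modulus_eq0 eq_le modulus_ge0 andbT.
apply/ler_addgt0Pl => e e0; rewrite addr0.
(* After n steps the distance bound is 8 |h| / 2^n: two coordinates contribute 2 |h| / 2^n each, and
   the triangle itself 4 |h| / 2^n. Multiplied by 4^n, the estimate becomes [c] times the tolerance,
   for every n. *)
pose c := 6 * `|h| * (8 * `|h|).
have c0 : 0 <= c by rewrite /c !mulr_ge0.
have ec : 0 < e / (c + 1) by rewrite divr_gt0// ltr_wpDl.
have [d d0 Hd] := triangle_estimate (l1, l2) ec.
have [n nd] : exists n, 8 * `|h| / 2 ^+ n < d.
  have x0 : 0 <= 8 * `|h| / d by rewrite !mulr_ge0// invr_ge0 ltW.
  exists (Num.bound (8 * `|h| / d)); rewrite ltr_pdivrMr ?exprn_gt0//.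
  rewrite [ltRHS]mulrC -ltr_pdivrMr// (lt_le_trans (archi_boundP x0))//.
  by rewrite -natrX ler_nat ltnW// ltn_expl.
have : modulus (triangle (x n).1 (x n).2) <=
    6 * (`|(x n).2| * (e / (c + 1) * (8 * `|h| / 2 ^+ n))).
  apply: Hd => //; rewrite /norm1 /= hn.
  by have := Hl1 n; have := Hl2 n; lra.
rewrite hn => H; apply: le_trans (Tn n) _.
apply: (@le_trans _ _ (c * (e / (c + 1)))); last first.
  by rewrite mulrCA ler_piMr ?(ltW e0)// ler_pdivrMr ?mul1r ?lerDl// ltr_wpDl.
apply: le_trans (ler_wpM2l (exprn_ge0 n (ler0n R 4)) H) _; clear H.
rewrite le_eqVlt; apply/orP; left; apply/eqP; rewrite /c.
rewrite (_ : 4 ^+ n = 2 ^+ n * 2 ^+ n :> R); last by rewrite -exprMn -natrM.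
by field; rewrite expf_neq0//= gt_eqF// ltr_wpDl.
Qed.

End Goursat.

Arguments norm1 {R} v : simpl never.
Arguments edge {R} G a v : simpl never.
Arguments triangle {R} G a h : simpl never.

(** * Local exactness of the pullback of f(z) dz along a C^1 map *)

Section PulledBackForm.
Variable R : realType.
Local Notation C := (Cplx R).
Local Notation V := (R * R)%type.
Variables (k : V -> C) (k' : V -> V -> C) (f : C -> C) (G : V -> V -> C).
Variables (p : V) (d0 L : R) (m : C).
Hypothesis d0_gt0 : 0 < d0.
Hypothesis k_deriv : forall y v, norm1 (y - p) < d0 -> unit_dir v ->
  vderiv (fun t => k (y + t *: v)) 0 (k' v y) /\ modulus (k' v y) <= L.
Hypothesis G_eq : forall y v, norm1 (y - p) < d0 -> unit_dir v ->
  G v y = f (k y) * k' v y.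
Hypothesis f_deriv : cderiv f (k p) m.

Lemma pulled_segment a h v : unit_dir v ->
  (forall t : R, 0 <= t <= 1 -> norm1 (a + t *: (h *: v) - p) < d0) ->
  modulus (k (a + h *: v) - k a) <= 2 * (`|h| * L).
Proof.
move=> uv near.
have -> : k (a + h *: v) - k a = k (a + 1 *: (h *: v)) - k (a + 0 *: (h *: v)).
  by rewrite scale1r scale0r addr0.
apply: (@vderiv_mean _ (fun t => k (a + t *: (h *: v)))
  (fun t => h%:C * k' v (a + t *: (h *: v)))) => t /near near_t.
  by apply: vderiv_line; have [] := k_deriv near_t uv.
by rewrite modulusM modulus_real ler_wpM2l//; have [] := k_deriv near_t uv.
Qed.

(** [y] is reached from [p] by a horizontal and then a vertical segment, because derivatives are
    bounded in the edge directions only. Both segments stay in the same [norm1]-ball. *)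
Lemma pulled_lipschitz y : norm1 (y - p) < d0 ->
  modulus (k y - k p) <= 2 * L * norm1 (y - p).
Proof.
rewrite {1}/norm1 /= => yd; pose q : V := p + (y.1 - p.1) *: ex R.
have qy : y = q + (y.2 - p.2) *: ey R by rewrite /q; vec_ring.
have b1 : modulus (k q - k p) <= 2 * (`|y.1 - p.1| * L).
  apply: pulled_segment; first by left.
  move=> t /andP[t0 t1]; apply: le_lt_trans yd; rewrite addrAC subrr add0r.
  rewrite !norm1Z /norm1 /= normr1 normr0 addr0 mulr1 ger0_norm//.
  by rewrite (le_trans (_ : _ <= `|y.1 - p.1|)) ?lerDl// ler_piMl.
have b2 : modulus (k y - k q) <= 2 * (`|y.2 - p.2| * L).
  rewrite {1}qy; apply: pulled_segment; first by right; left.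
  move=> t /andP[t0 t1]; apply: le_lt_trans yd.
  rewrite (_ : q + _ - p = (y.1 - p.1, t * (y.2 - p.2))); last first.
    by rewrite /q; vec_ring.
  by rewrite /norm1 /= lerD2l normrM ger0_norm// ler_piMl.
have -> : k y - k p = (k y - k q) + (k q - k p) by ring.
rewrite (le_trans (modulusD _ _))// (le_trans (lerD b2 b1))// /norm1 /=.
by rewrite le_eqVlt; apply/orP; left; apply/eqP; ring.
Qed.

(** The Taylor remainder of [f] at [k p] is small compared with |k y - k p|, which is at most 2 L |y
    - p|; the factor [k'] contributes another L. Dividing [e] by [2 * L * L + 1] compensates, the 1
    covering the case L = 0. *)
Lemma pulled_exact (e : R) : 0 < e ->
  exists2 d : R, 0 < d & exists P : V -> C, forall y v,
    norm1 (y - p) < d -> unit_dir v ->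
    exists l, vderiv (fun t => P (y + t *: v)) 0 l /\
              modulus (G v y - l) <= e * norm1 (y - p).
Proof.
move=> e0.
have pd : norm1 (p - p) < d0 by rewrite subrr /norm1 /= normr0 addr0.
have L0 : 0 <= L.
  have [_] := k_deriv pd (or_introl erefl : unit_dir (ex R)).
  by apply: le_trans; exact: modulus_ge0.
have K0 : 0 < 2 * L * L + 1 by rewrite ltr_wpDl// !mulr_ge0.
have [|d1 d10 Hd1] := (cderivE _ _ _).1 f_deriv (e / (2 * L * L + 1)).
  by rewrite divr_gt0.
have L1 : 0 < 2 * L + 1 by rewrite ltr_wpDl// mulr_ge0.
exists (Num.min d0 (d1 / (2 * L + 1))); first by rewrite lt_min d0_gt0 divr_gt0.
(* A primitive of the first-order Taylor polynomial of [f] at [k p], composed with [k]. *)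
pose P y := f (k p) * k y + m / 2 * ((k y - k p) * (k y - k p)).
exists P => y v; rewrite lt_min => /andP[yd yd1] uv.
have [dk kL] := k_deriv yd uv.
exists ((f (k p) + m * (k y - k p)) * k' v y); split.
  have dkp := has_derivB dk (has_deriv_cst _ (k p) 0).
  have := has_derivD (has_derivZ (f (k p)) dk)
    (has_derivZ (m / 2) (has_derivM dkp dkp)).
  by rewrite scale0r addr0; congr (vderiv _ _ _); field.
rewrite (G_eq yd uv) -mulrBl modulusM.
have lip := pulled_lipschitz yd.
have small : modulus (k y - k p) < d1.
  rewrite (le_lt_trans lip)//; rewrite ltr_pdivlMr// in yd1.
  apply: le_lt_trans yd1; rewrite mulrC ler_wpM2l ?lerDl//.
  by rewrite /norm1 addr_ge0.
have := Hd1 _ small; rewrite [k p + _]addrC subrK opprD addrA => h.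
apply: le_trans (ler_pM (modulus_ge0 _) (modulus_ge0 _) h kL) _.
have n0 : 0 <= norm1 (y - p) by rewrite /norm1 addr_ge0.
apply: (@le_trans _ _ (e / (2 * L * L + 1) * (2 * L * norm1 (y - p)) * L)).
  by rewrite ler_wpM2r// ler_wpM2l// ltW// divr_gt0.
rewrite [leLHS](_ : _ = e * norm1 (y - p) * ((2 * L * L) / (2 * L * L + 1))).
  rewrite ler_piMr ?mulr_ge0// ?(ltW e0)//.
  by rewrite ler_pdivrMr// mul1r lerDl.
by field; rewrite gt_eqF.
Qed.

End PulledBackForm.

Section ExactOfC1.
Variable R : realType.
Local Notation C := (Cplx R).
Local Notation V := (R * R)%type.

Lemma near_norm1 (p : V) (Q : V -> Prop) : (\forall y \near p, Q y) ->
  exists2 d : R, 0 < d & forall y, norm1 (y - p) < d -> Q y.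
Proof.
move=> /nbhs_ballP[d /= d0 H]; exists d => // y yd; apply: H.
split; rewrite -ball_normE /= distrC; apply: le_lt_trans yd.
  by rewrite /norm1 lerDl.
by rewrite /norm1 lerDr.
Qed.

Lemma exact_of_C1 (k : V -> C) (k' : V -> V -> C) (f : C -> C)
    (G : V -> V -> C) (p : V) (d0 : R) (m : C) : 0 < d0 ->
  (forall v, {for p, continuous (k' v)}) ->
  (forall y v, norm1 (y - p) < d0 -> unit_dir v ->
     vderiv (fun t => k (y + t *: v)) 0 (k' v y)) ->
  (forall y v, norm1 (y - p) < d0 -> unit_dir v -> G v y = f (k y) * k' v y) ->
  cderiv f (k p) m ->
  forall e : R, 0 < e ->
  exists2 d : R, 0 < d & exists P : V -> C, forall y v,
    norm1 (y - p) < d -> unit_dir v ->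
    exists l, vderiv (fun t => P (y + t *: v)) 0 l /\
              modulus (G v y - l) <= e * norm1 (y - p).
Proof.
move=> d00 ck dk Gk fm e e0; pose B v := modulus (k' v p) + 1.
have bound v : \forall y \near p, modulus (k' v y) < B v.
  have := proj1 (cvg_modulus _ _ _) (ck v) 1 ltr01.
  move=> /(_ _); apply: filterS => y h.
  by rewrite -ltrBlDl; apply: le_lt_trans (ler_modulusB _ _) h.
have [d2 d20 bx] := near_norm1 (bound (ex R)).
have [d3 d30 by_] := near_norm1 (bound (ey R)).
have [d4 d40 bxy] := near_norm1 (bound (ey R - ex R)).
have B0 v : 0 <= B v by rewrite addr_ge0 ?modulus_ge0.
(* The sum of the three bounds serves as a common bound for all edge directions. *)
pose L := B (ex R) + B (ey R) + B (ey R - ex R).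
apply: (@pulled_exact _ k k' f G p
  (Num.min (Num.min d0 d2) (Num.min d3 d4)) L m _ _ _ fm e e0).
- by rewrite !lt_min d00 d20 d30 d40.
- move=> y v; rewrite !lt_min => /andP[/andP[y1 y2] /andP[y3 y4]] uv.
  split; first exact: dk.
  rewrite /L; case: uv => [->|[->|->]].
  + by apply: le_trans (ltW (bx _ y2)) _; rewrite -addrA lerDl addr_ge0.
  + by apply: le_trans (ltW (by_ _ y3)) _; rewrite addrAC lerDr addr_ge0.
  + by apply: le_trans (ltW (bxy _ y4)) _; rewrite lerDr addr_ge0.
- move=> y v; rewrite !lt_min => /andP[/andP[y1 _] _] uv; exact: Gk.
Qed.

End ExactOfC1.

(** * Holomorphic maps and forms in charts *)

Section HolomorphicMaps.
Variable R : realType.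
Local Notation C := (Cplx R).
Implicit Types S T U : riemann_surface R.

Lemma cderiv_continuous (f : C -> C) z l : cderiv f z l ->
  {for z, continuous f}.
Proof.
move=> /has_deriv_cont H.
apply: (proj2 (@cvg_modulus R _ (nbhs z) f (f z) _)) => e /H[d d0 {}H].
apply/near_modulus; exists d => // w /H /=; rewrite [z + _]addrC subrK; exact.
Qed.

(** For [r = id] this is a change of coordinates, so one chain rule covers both maps and
    transitions. *)
Definition local_map S T (r : S -> T) (p : S) (q : T) : C -> C :=
  chart q \o r \o param p.

Lemma local_mapE S T (r : S -> T) p q x : chart_dom p x ->
  local_map r p q (chart p x) = chart q (r x).
Proof. by move=> px; rewrite /local_map /= chartK. Qed.

Lemma local_map_deriv S T (r : S -> T) p q x : holomorphic r ->
  chart_dom p x -> chart_dom q (r x) ->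
  cderiv (local_map r p q) (chart p x) (derive1 (local_map r p q) (chart p x)).
Proof. by move=> [_ hr] px qx; apply/cderivP; split => //; exact: hr. Qed.

Lemma holomorphic_id S : holomorphic (id : S -> S).
Proof.
split=> [x|p q x px qx]; first exact: cvg_id.
exact: (transition_holomorphic px qx).
Qed.

(** [param p] is a right inverse of [chart p] only on the image of the domain; openness of that
    image provides a disc on which both are inverse to each other. *)
Lemma chart_nbhs S (p x : S) (A : set S) : chart_dom p x -> nbhs x A ->
  exists2 d : R, 0 < d & forall z : C, modulus (z - chart p x) < d ->
    [/\ chart_dom p (param p z), chart p (param p z) = z & A (param p z)].
Proof.
move=> px xA.
have /nbhs_modulus[d1 d10 H1] : nbhs (chart p x) (chart p @` chart_dom p).
  by apply: open_nbhs_nbhs; split; [exact: chart_open|exists x].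
have /nbhs_modulus[d2 d20 H2] : nbhs (chart p x) (param p @^-1` A).
  by apply: param_continuous => //; rewrite chartK.
exists (Num.min d1 d2) => [|z]; first by rewrite lt_min d10.
rewrite lt_min => /andP[/H1[y py <-] /H2 Az].
by move: Az; rewrite /preimage /= (chartK py) => Az; split.
Qed.

Lemma nbhs_preimage S T (r : S -> T) q x : continuous r -> chart_dom q (r x) ->
  nbhs x [set y | chart_dom q (r y)].
Proof.
move=> cr qx; apply: cr; apply: open_nbhs_nbhs; split => //; exact: dom_open.
Qed.

Lemma local_map_comp S T U (r : S -> T) (r' : T -> U) p q q' x :
  holomorphic r -> holomorphic r' ->
  chart_dom p x -> chart_dom q (r x) -> chart_dom q' (r' (r x)) ->
  derive1 (local_map (r' \o r) p q') (chart p x) =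
  derive1 (local_map r' q q') (chart q (r x)) *
  derive1 (local_map r p q) (chart p x).
Proof.
move=> hr hr' px qx q'x.
have h1 := local_map_deriv hr px qx.
have h2 := local_map_deriv hr' qx q'x.
rewrite -(local_mapE r q px) in h2.
have [d d0 near] := chart_nbhs px (nbhs_preimage hr.1 qx).
rewrite -(local_mapE r q px).
suff /cderivP[_ ->] : cderiv (local_map (r' \o r) p q') (chart p x)
  (derive1 (local_map r' q q') (local_map r p q (chart p x)) *
   derive1 (local_map r p q) (chart p x)) by [].
apply: has_deriv_near d0 _ (has_deriv_comp h1 h2) => h /= hd.
have [|_ _ /= qz] := near (chart p x + h); first by rewrite addrC addKr.
by rewrite /local_map /= chartK.
Qed.

Lemma vderiv_chart S T (r : S -> T) p q (g : R -> S) t l : holomorphic r ->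
  {for t, continuous g} -> chart_dom p (g t) -> chart_dom q (r (g t)) ->
  vderiv (chart p \o g) t l ->
  vderiv (chart q \o (r \o g)) t (derive1 (local_map r p q) (chart p (g t)) * l).
Proof.
move=> hr cg pg qg dg.
have h := local_map_deriv hr pg qg.
have : nbhs t [set u | chart_dom p (g u)].
  by apply: cg; apply: open_nbhs_nbhs; split => //; exact: dom_open.
move=> /nbhs_ballP[d /= d0 near].
apply: has_deriv_near d0 _ (has_deriv_comp dg h) => u.
rewrite modulus_real /= => ud; rewrite /local_map /= chartK//.
by apply: near; rewrite -ball_normE /= opprD addrA subrr add0r normrN.
Qed.

Lemma velocityP S (p : S) (g : R -> S) t l :
  vderiv (chart p \o g) t l -> velocity p g t = l.
Proof. by move=> /vderivP[]. Qed.

Lemma form_coefE S (w : S -> C) p x : chart_dom p x ->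
  form_coef w p (chart p x) = w x * derive1 (local_map id p x) (chart p x).
Proof. by move=> px; rewrite /form_coef chartK. Qed.

(** The integrand is defined in the chart centred at [g t], which moves with [t]; the chain rule
    allows any chart containing the point. *)
Lemma form_coef_velocity S (w : S -> C) p (g : R -> S) t l :
  {for t, continuous g} -> chart_dom p (g t) -> vderiv (chart p \o g) t l ->
  w (g t) * velocity (g t) g t = form_coef w p (chart p (g t)) * l.
Proof.
move=> cg pg dg; rewrite form_coefE// -mulrA; congr (_ * _).
exact: velocityP (vderiv_chart (holomorphic_id _) cg pg (dom_center _) dg).
Qed.

(** A form is stored at [x] by its coefficient with respect to the differential of [chart x], so the
    derivative of [r] is taken between the charts centred at [x] and [r x]. *)
Definition pullback S T (r : S -> T) (w : T -> C) (x : S) : C :=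
  w (r x) * derive1 (local_map r x (r x)) (chart x x).

(** The derivative of [r] from the chart [p] to the chart centred at [r x] is computed twice: as
    [r \o id] through the chart centred at [x], and as [id \o r] through [q]. *)
Lemma form_coef_pullback S T (r : S -> T) (w : T -> C) p q x : holomorphic r ->
  chart_dom p x -> chart_dom q (r x) ->
  form_coef (pullback r w) p (chart p x) =
  form_coef w q (local_map r p q (chart p x)) *
  derive1 (local_map r p q) (chart p x).
Proof.
move=> hr px qx.
have idS := @holomorphic_id S; have idT := @holomorphic_id T.
rewrite (local_mapE r q px) (form_coefE _ px) (form_coefE _ qx) /pullback.
have E1 := local_map_comp idS hr px (dom_center x) (dom_center (r x)).
have E2 := local_map_comp hr idT px qx (dom_center (r x)).
apply: etrans (esym (mulrA _ _ _)) _; apply: etrans (mulrA _ _ _).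
exact: (congr1 (fun c => w (r x) * c) (etrans (esym E1) E2)).
Qed.

Lemma pullback_velocity S T (r : S -> T) (w : T -> C) p (g : R -> S) t l :
  holomorphic r ->
  {for t, continuous g} -> chart_dom p (g t) -> vderiv (chart p \o g) t l ->
  pullback r w (g t) * velocity (g t) g t =
  w ((r \o g) t) * velocity ((r \o g) t) (r \o g) t.
Proof.
move=> hr cg pg dg; rewrite /pullback -mulrA; congr (_ * _).
have dc := vderiv_chart (holomorphic_id _) cg pg (dom_center (g t)) dg.
rewrite (velocityP dc).
by rewrite (velocityP (vderiv_chart hr cg (dom_center _) (dom_center (r (g t))) dc)).
Qed.

End HolomorphicMaps.

(** * Forms pulled back along C^1 maps *)

Section C1Maps.
Variable R : realType.
Local Notation C := (Cplx R).
Variables (S : riemann_surface R) (w : S -> C).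
Hypothesis w_holo : holomorphic_form w.

Lemma form_coef_deriv p x : chart_dom p x ->
  exists l, cderiv (form_coef w p) (chart p x) l.
Proof.
move=> px; exists (derive1 (form_coef w p) (chart p x)); apply/cderivP.
by split=> //; exact: w_holo.
Qed.

Section Along.
Variables (V : normedModType R) (sigma : V -> S).
Hypothesis sigma_C1 : C1_map sigma.

Definition form_along (v y : V) : C :=
  w (sigma y) * velocity (sigma y) (fun t => sigma (y + t *: v)) 0.

Definition dchart (p : S) (v y : V) : C :=
  'D_v (fun x => complex.Re (chart p (sigma x))) y +i*
  'D_v (fun x => complex.Im (chart p (sigma x))) y.

Lemma derivable_line (f : V -> R) y v : derivable f y v ->
  derivable (fun t : R => f (y + t *: v)) 0 1 /\
  derive1 (fun t : R => f (y + t *: v)) 0 = 'D_v f y.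
Proof.
have E : (fun h : R => h^-1 *: (((fun t : R => f (y + t *: v)) \o shift 0) (h *: 1)
    - f (y + 0 *: v))) = fun h => h^-1 *: ((f \o shift y) (h *: v) - f y).
  apply/funext => h /=; rewrite addr0 scale0r addr0 [h%:A]mulr1.
  by rewrite [y + _]addrC.
move=> df; rewrite derive1E /derivable /derive.
by split; [rewrite E|congr (lim _); rewrite E].
Qed.

Lemma vderiv_dchart p v y : chart_dom p (sigma y) ->
  vderiv (fun t : R => chart p (sigma (y + t *: v))) 0 (dchart p v y).
Proof.
move=> py; have [/(_ v)[dr _] /(_ v)[di _]] := sigma_C1.2 p y py.
have [r1 r2] := derivable_line dr; have [i1 i2] := derivable_line di.
by apply/vderivP; split; [exact: r1|exact: i1|rewrite r2 i2].
Qed.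

Lemma dchart_continuous p v y : chart_dom p (sigma y) ->
  {for y, continuous (dchart p v)}.
Proof.
move=> py; have [/(_ v)[_ cr] /(_ v)[_ ci]] := sigma_C1.2 p y py.
by apply/cvg_complex; split; [exact: cr|exact: ci].
Qed.

Lemma line_continuous (y v : V) :
  {for 0, continuous (fun t : R => sigma (y + t *: v))}.
Proof.
apply: continuous_comp; last exact: sigma_C1.1.
by apply: cvgD; [exact: cvg_cst|apply: cvgZ; [exact: cvg_id|exact: cvg_cst]].
Qed.

(** The chart in [form_along] depends on [y]; fixing [p] is what makes continuity and homogeneity
    provable. *)
Lemma form_along_chart p v y : chart_dom p (sigma y) ->
  form_along v y = form_coef w p (chart p (sigma y)) * dchart p v y.
Proof.
move=> py; have dk := vderiv_dchart v py; rewrite /form_along.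
have := @form_coef_velocity _ _ w p (fun t => sigma (y + t *: v)) 0 _
  (@line_continuous y v).
by rewrite scale0r addr0 => /(_ _ py dk).
Qed.

Lemma chart_dom_near p y : chart_dom p (sigma y) ->
  \forall x \near y, chart_dom p (sigma x).
Proof.
move=> py; apply: sigma_C1.1; apply: open_nbhs_nbhs; split=> //.
exact: dom_open.
Qed.

Lemma form_along_continuous v : continuous (form_along v).
Proof.
move=> y; set p := sigma y; have py : chart_dom p (sigma y) := dom_center _.
have near : \forall x \near y,
    form_coef w p (chart p (sigma x)) * dchart p v x = form_along v x.
  by apply: filterS (chart_dom_near py) => x px; rewrite (form_along_chart v px).
rewrite /prop_for /continuous_at (form_along_chart v py).
apply: cvg_trans (near_eq_cvg near) _.
apply: cvgM; last exact: dchart_continuous.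
have [l /cderiv_continuous cf] := form_coef_deriv py.
apply: (@continuous_comp _ _ _ (fun x => chart p (sigma x))); last exact: cf.
by apply: continuous_comp; [exact: sigma_C1.1|exact: chart_continuous].
Qed.

Lemma form_along_homogeneous (k : R) v y :
  form_along (k *: v) y = k%:C * form_along v y.
Proof.
have py := dom_center (sigma y).
rewrite !(form_along_chart _ py) mulrCA; congr (_ * _).
have h := vderiv_dchart v py; rewrite -(mulr0 k) -(addr0 (k * 0)) in h.
apply: vderiv_uniq (vderiv_dchart (k *: v) py) _.
have := vderiv_affine h; apply: has_deriv_eq => t.
by rewrite addr0 scalerA mulrC.
Qed.

End Along.

End C1Maps.

Section PathIntegrand.
Variable R : realType.
Local Notation C := (Cplx R).

Definition path_integrand (S : riemann_surface R) (w : S -> C) (g : R -> S)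
  (t : R) : C := w (g t) * velocity (g t) g t.

Lemma path_integralE (S : riemann_surface R) (w : S -> C) (g : R -> S) :
  path_integral w g = cint (path_integrand w g).
Proof. by []. Qed.

(** A curve is a C^1 map on the normed space [R] with direction 1, so the continuity result for
    [form_along] applies to curves and triangles alike. *)
Lemma path_integrand_along (S : riemann_surface R) (w : S -> C) (g : R -> S) :
  path_integrand w g = form_along w g 1.
Proof.
apply/funext => t; rewrite /form_along; congr (_ * _); rewrite /velocity.
have E (f : R -> R) : derive1 (fun u : R => f (t + u *: 1)) 0 = derive1 f t.
  rewrite /derive1; have -> : (fun h : R => h^-1 *: (f (t + (h + 0) *: 1) -
      f (t + 0 *: 1))) = fun h => h^-1 *: (f (h + t) - f t).
    by apply/funext => h; rewrite addr0 scale0r addr0 [h *: 1]mulr1 [t + h]addrC.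
  by [].
by rewrite (E (fun u => complex.Re (chart (g t) (g u))))
  (E (fun u => complex.Im (chart (g t) (g u)))).
Qed.

Lemma path_integrand_line (S : riemann_surface R) (w : S -> C)
    (sigma : R * R -> S) (a v : R * R) :
  path_integrand w (fun t => sigma (a + t *: v)) =
  fun t => form_along w sigma v (a + t *: v).
Proof.
rewrite path_integrand_along; apply/funext => t.
rewrite /form_along; congr (_ * velocity _ _ 0); apply/funext => s.
by rewrite scalerDl addrA [s *: 1]mulr1.
Qed.

Lemma path_integral_line (S : riemann_surface R) (w : S -> C)
    (sigma : R * R -> S) (a v : R * R) :
  path_integral w (fun t => sigma (a + t *: v)) =
  edge (form_along w sigma) a v.
Proof. by rewrite path_integralE path_integrand_line. Qed.

End PathIntegrand.

(** * Vanishing of integrals over boundaries of singular triangles *)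

Section Stokes.
Variable R : realType.
Local Notation C := (Cplx R).
Local Notation V := (R * R)%type.

Lemma integral_triangle_boundary (S : riemann_surface R) (w : S -> C)
    (sigma : V -> S) : holomorphic_form w -> C1_map sigma ->
  path_integral w (fun t => sigma (1 - t, t)) -
  path_integral w (fun t => sigma (0, t)) +
  path_integral w (fun t => sigma (t, 0)) = 0.
Proof.
move=> hw cs.
have := @goursat R (form_along w sigma) (form_along_continuous hw cs)
  (form_along_homogeneous w cs) _ 0 1.
rewrite /triangle -!path_integral_line => H.
have E1 : (fun t : R => sigma (0 + 1 *: ex R + t *: (1 *: (ey R - ex R)))) =
    (fun t => sigma (1 - t, t)).
  by apply/funext => t; congr sigma; vec_ring.
have E2 : (fun t : R => sigma (0 + t *: (1 *: ey R))) = (fun t => sigma (0, t)).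
  by apply/funext => t; congr sigma; vec_ring.
have E3 : (fun t : R => sigma (0 + t *: (1 *: ex R))) = (fun t => sigma (t, 0)).
  by apply/funext => t; congr sigma; vec_ring.
rewrite E1 E2 E3 in H; rewrite addrC addrA H// => p e e0.
(* Only the local exactness required by [goursat] remains; at [p] it is checked in the chart centred
   at [sigma p]. *)
have pp := dom_center (sigma p).
have [d d0 near_chart] := near_norm1 (chart_dom_near cs pp).
have [m fm] := form_coef_deriv hw pp.
apply: (@exact_of_C1 _ (fun y => chart (sigma p) (sigma y))
  (dchart sigma (sigma p)) (form_coef w (sigma p)) _ _ d m d0 _ _ _ fm e e0).
- by move=> v; exact: dchart_continuous pp.
- by move=> y v yd _; exact: vderiv_dchart (near_chart _ yd).
- by move=> y v yd _; exact: form_along_chart (near_chart _ yd).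
Qed.

End Stokes.

(** * Cauchy's formula *)

Section Circle.
Variable R : realType.
Local Notation C := (Cplx R).

Lemma vderiv_continuous (k : R -> C) t l : vderiv k t l ->
  {for t, continuous k}.
Proof.
move=> /has_deriv_cont H.
apply: (proj2 (@cvg_modulus R _ (nbhs t) k (k t) _)) => e /H[d d0 {}H].
apply/nbhs_ballP; exists d => // s; rewrite -ball_normE /= distrC => sd.
by have := H (s - t); rewrite modulus_real [t + _]addrC subrK => /(_ sd).
Qed.

Definition cis (u : R) : C := cos u +i* sin u.

Lemma vderiv_cis u : vderiv cis u ((0 +i* 1) * cis u).
Proof.
apply/vderivP; split; [exact: derivable_cos|exact: derivable_sin|].
rewrite !derive1E.
have -> : 'D_1 (fun v : R => complex.Re (cis v)) u = - sin u.
  exact: (@derive_val _ _ _ _ _ _ _ (is_derive_cos u)).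
have -> : 'D_1 (fun v : R => complex.Im (cis v)) u = cos u.
  exact: (@derive_val _ _ _ _ _ _ _ (is_derive_sin u)).
by rewrite /cis; simpc.
Qed.

Lemma modulus_cis u : modulus (cis u) = 1.
Proof. by rewrite /modulus /= cos2Dsin2 sqrtr1. Qed.

Lemma modulus_i : modulus (0 +i* 1 : C) = 1.
Proof. by rewrite /modulus /= expr0n expr1n /= add0r sqrtr1. Qed.

Variables (z0 : C) (r : R).
Hypothesis r0 : 0 < r.

(** The summand 0 gives the angle the shape [k * t + a] of the rules for affine substitution. *)
Definition circle (t : R) : C := z0 + r%:C * cis (2 * pi * t + 0).
Definition circle' (t : R) : C :=
  r%:C * ((2 * pi)%:C * ((0 +i* 1) * cis (2 * pi * t + 0))).

Lemma vderiv_circle t : vderiv circle t (circle' t).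
Proof.
have := has_derivZ r%:C (vderiv_affine (vderiv_cis (2 * pi * t + 0))).
by move=> /(has_derivD (has_deriv_cst _ z0 t)); rewrite add0r.
Qed.

Lemma circle_continuous : continuous circle.
Proof. by move=> t; exact: vderiv_continuous (vderiv_circle t). Qed.

Lemma circle'_continuous : continuous circle'.
Proof.
do 3 apply: continuous_cmul; apply: continuous_affine => u.
exact: vderiv_continuous (vderiv_cis u).
Qed.

Lemma modulus_circle t : modulus (circle t - z0) = r.
Proof.
rewrite /circle addrC addrA addNr add0r modulusM modulus_cis modulus_real mulr1.
by rewrite gtr0_norm.
Qed.

Lemma modulus_circle' t : modulus (circle' t) = 2 * pi * r.
Proof.
rewrite /circle' !modulusM !modulus_real modulus_cis modulus_i !mulr1 mulrC.
by rewrite !gtr0_norm// mulr_gt0// pi_gt0.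
Qed.

Lemma circle_closed : circle 1 = circle 0.
Proof.
rewrite /circle /cis !addr0 mulr1 mulr0; congr (_ + _ * (_ +i* _)).
  by rewrite cos0 mulr_natl cos2pi.
by rewrite sin0 mulr_natl sin2pi.
Qed.

Lemma circle_far z t : r - modulus (z - z0) <= modulus (circle t - z).
Proof.
have := ler_modulusB (circle t - z0) (z - z0).
by rewrite modulus_circle opprB addrA subrK.
Qed.

Lemma circle_neq z t : modulus (z - z0) < r -> circle t - z != 0.
Proof.
by move=> zr; rewrite -modulus_gt0 (lt_le_trans _ (circle_far z t))// subr_gt0.
Qed.

End Circle.

Section CauchyFormula.
Variable R : realType.
Local Notation C := (Cplx R).
Local Notation V := (R * R)%type.
Variables (f : C -> C) (z0 : C) (r : R).
Hypothesis r0 : 0 < r.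
Hypothesis f_holo : forall z, modulus (z - z0) < 2 * r -> exists l, cderiv f z l.
Local Notation circle := (circle z0 r).
Local Notation circle' := (circle' r).

(** The unit square is cut by its antidiagonal into the triangle of scale 1 at the origin and the
    triangle of scale -1 at the opposite corner; the diagonal cancels in the sum. *)
Lemma square_edges (G : V -> V -> C) :
  (forall v, continuous (G v)) ->
  (forall (k : R) v y, G (k *: v) y = k%:C * G v y) ->
  (forall a h, triangle G a h = 0) ->
  edge G 0 (ex R) + edge G (ex R) (ey R) =
  edge G 0 (ey R) + edge G (ey R) (ex R).
Proof.
move=> cG hG tri.
have h1 := tri 0 1; have h2 := tri (ex R + ey R) (-1).
rewrite /triangle !scale1r add0r in h1.
have e1 : ex R + ey R - ex R = ey R by rewrite addrC addKr.
have e2 : edge G (ex R + ey R) (- ex R) = - edge G (ey R) (ex R).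
  by rewrite addrC edge_rev.
have e3 : edge G (ex R + ey R) (- ey R) = - edge G (ex R) (ey R).
  by rewrite edge_rev.
have e4 : edge G (ey R) (- (ey R - ex R)) = - edge G (ex R) (ey R - ex R).
  by rewrite -edge_rev// [ex R + _]addrC subrK.
rewrite /triangle !scaleN1r e1 e2 e3 e4 in h2.
apply/eqP; rewrite -subr_eq0; apply/eqP.
transitivity ((edge G 0 (ex R) + edge G (ex R) (ey R - ex R) - edge G 0 (ey R)) +
  (- edge G (ey R) (ex R) - edge G (ex R) (ey R - ex R) - - edge G (ex R) (ey R))).
  by ring.
by rewrite h1 h2 addr0.
Qed.

Section Homotopy.
Variables (z : C) (c : R).
Hypothesis zr : modulus (z - z0) < r.
Hypothesis c0 : 0 <= c.

(* The circle is contracted towards z; the factor 1 / (1 + c s^2) lies in (0, 1]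
   for all real s, so the contraction never reaches z. *)
Definition shrink (s : R) : R := (1 + c * s ^+ 2)^-1.

Lemma shrink_gt0 s : 0 < shrink s.
Proof. by rewrite /shrink invr_gt0 ltr_pwDl// mulr_ge0// sqr_ge0. Qed.

Lemma shrink_le1 s : shrink s <= 1.
Proof.
have cs : 0 <= c * s ^+ 2 by rewrite mulr_ge0// sqr_ge0.
by rewrite /shrink invf_le1 ?lerDl// ltr_pwDl.
Qed.

Definition shrink' (s : R) : C :=
  - ((1 + c%:C * (s%:C * s%:C)) ^+ 2)^-1 * (c%:C * (s%:C + s%:C)).

Lemma shrinkE s : (shrink s)%:C = (1 + c%:C * (s%:C * s%:C))^-1 :> C.
Proof.
rewrite /shrink (fmorphV (real_complex R)) (rmorphD (real_complex R)) rmorph1.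
by rewrite (rmorphM (real_complex R)) (rmorphXn (real_complex R)) expr2.
Qed.

Lemma vderiv_shrink s : vderiv (fun s => (shrink s)%:C) s (shrink' s).
Proof.
apply: (has_deriv_eq (f := fun s : R => (1 + c%:C * (s%:C * s%:C))^-1)).
  by move=> u; rewrite shrinkE.
have dsq := has_derivM (has_deriv_incl (real_complex R) s)
  (has_deriv_incl (real_complex R) s).
rewrite mul1r mulr1 in dsq.
have := has_derivD (has_deriv_cst _ 1 s) (has_derivZ c%:C dsq).
rewrite add0r => dd; apply: has_deriv_comp dd _; apply: cderiv_inv.
by rewrite -invr_eq0 -shrinkE -modulus_gt0 modulus_real gtr0_norm// shrink_gt0.
Qed.

Lemma shrink'_continuous : continuous shrink'.
Proof.
have ci : continuous (real_complex R : R -> C).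
  by move=> s; exact: vderiv_continuous (has_deriv_incl _ s).
have cs : continuous (fun s : R => (shrink s)%:C : C).
  by move=> s; exact: vderiv_continuous (vderiv_shrink s).
rewrite (_ : shrink' = fun s => - ((shrink s)%:C * (shrink s)%:C) *
    (c%:C * (s%:C + s%:C))).
  move=> s; apply: cvgM; first by apply: cvgN; apply: cvgM; exact: cs.
  by apply: cvgM; [exact: cvg_cst|apply: cvgD; exact: ci].
apply/funext => s; rewrite /shrink' !shrinkE; congr (- _ * _).
by rewrite expr2 invfM.
Qed.

(** [y.2] runs along the circle and [y.1] is the homotopy parameter: at 0 the circle itself, at 1
    its image under the homothety of centre [z] and ratio 1 / (1 + c). *)
Definition contraction (y : V) : C := z + (shrink y.1)%:C * (circle y.2 - z).
Definition dcontraction (v y : V) : C :=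
  v.1%:C * (shrink' y.1 * (circle y.2 - z)) +
  v.2%:C * ((shrink y.1)%:C * circle' y.2).

Lemma vderiv_contraction v y :
  vderiv (fun t => contraction (y + t *: v)) 0 (dcontraction v y).
Proof.
have a1 : v.1 * 0 + y.1 = y.1 by rewrite mulr0 add0r.
have a2 : v.2 * 0 + y.2 = y.2 by rewrite mulr0 add0r.
have d1 := vderiv_shrink y.1; rewrite -a1 in d1; have {}d1 := vderiv_affine d1.
have d2 := vderiv_circle z0 r y.2; rewrite -a2 in d2.
have {}d2 := has_derivB (vderiv_affine d2) (has_deriv_cst _ z 0).
have := has_derivD (has_deriv_cst _ z 0) (has_derivM d1 d2).
rewrite add0r !a1 !a2 subr0 => dd.
rewrite /dcontraction [in X in _ + X]mulrCA [in X in X + _]mulrA.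
apply: has_deriv_eq dd => t.
by rewrite /contraction /= /GRing.scale /= ![t * _]mulrC ![_ + v.1 * t]addrC
  ![_ + v.2 * t]addrC.
Qed.

Lemma continuous_fst_comp (h : R -> C) : continuous h ->
  continuous (fun y : V => h y.1).
Proof. by move=> ch y; apply: (@continuous_comp _ _ _ fst); [exact: cvg_fst|exact: ch]. Qed.

Lemma continuous_snd_comp (h : R -> C) : continuous h ->
  continuous (fun y : V => h y.2).
Proof. by move=> ch y; apply: (@continuous_comp _ _ _ snd); [exact: cvg_snd|exact: ch]. Qed.

Lemma shrink_fst_continuous : continuous (fun y : V => (shrink y.1)%:C : C).
Proof.
apply: (@continuous_fst_comp (fun s => (shrink s)%:C)) => s.
exact: vderiv_continuous (vderiv_shrink s).
Qed.

Lemma circle_snd_continuous : continuous (fun y : V => circle y.2 - z).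
Proof.
move=> y; apply: cvgB; last exact: cvg_cst.
exact: (continuous_snd_comp (@circle_continuous _ z0 r)).
Qed.

Lemma contraction_continuous : continuous contraction.
Proof.
move=> y; apply: cvgD; first exact: cvg_cst.
by apply: cvgM; [exact: shrink_fst_continuous|exact: circle_snd_continuous].
Qed.

Lemma dcontraction_continuous v : continuous (dcontraction v).
Proof.
move=> y; apply: cvgD; apply: cvgM; try exact: cvg_cst.
  apply: cvgM; last exact: circle_snd_continuous.
  exact: (continuous_fst_comp shrink'_continuous).
apply: cvgM; first exact: shrink_fst_continuous.
exact: (continuous_snd_comp (@circle'_continuous _ r)).
Qed.

Lemma contraction_neq y : contraction y - z != 0.
Proof.
rewrite /contraction addrC addKr mulf_neq0 ?circle_neq//.
by rewrite -modulus_gt0 modulus_real gtr0_norm shrink_gt0.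
Qed.

Lemma contraction_near y : modulus (contraction y - z0) <= r.
Proof.
have s0 := shrink_gt0 y.1; have s1 := shrink_le1 y.1.
have -> : contraction y - z0 = (1 - shrink y.1)%:C * (z - z0) +
    (shrink y.1)%:C * (circle y.2 - z0).
  by rewrite (rmorphB (real_complex R)) rmorph1 /contraction; ring.
rewrite (le_trans (modulusD _ _))// !modulusM !modulus_real modulus_circle//.
rewrite (gtr0_norm s0) ger0_norm ?subr_ge0//.
have h : (1 - shrink y.1) * modulus (z - z0) <= (1 - shrink y.1) * r.
  by rewrite ler_wpM2l ?subr_ge0// ltW.
by apply: le_trans (lerD h (lexx _)) _; rewrite -mulrDl subrK mul1r.
Qed.

Definition quotient (x : C) : C := (f x - f z) * (x - z)^-1.

Lemma quotient_deriv x : modulus (x - z0) < 2 * r -> x - z != 0 ->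
  exists l, cderiv quotient x l.
Proof.
move=> /f_holo[l fl] xz.
have d1 := has_derivB (cderiv_id x) (has_deriv_cst _ z x).
have d2 := has_deriv_comp d1 (cderiv_inv xz).
by eexists; exact: has_derivM (has_derivB fl (has_deriv_cst _ (f z) x)) d2.
Qed.

(** The circle being closed, the sides of the parameter square at angles 0 and 1 have equal
    integrals. They cancel in [square_edges], which leaves the original and the contracted
    circle. *)
Lemma contraction_homotopy :
  cint (fun t => quotient (circle t) * circle' t) =
  cint (fun t => quotient (z + (shrink 1)%:C * (circle t - z)) *
                 ((shrink 1)%:C * circle' t)).
Proof.
pose G v y := quotient (contraction y) * dcontraction v y.
have near2 y : modulus (contraction y - z0) < 2 * r.
  by rewrite (le_lt_trans (contraction_near y))// mulr_natl mulr2n ltrDl.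
have cG v : continuous (G v).
  move=> y; apply: cvgM; last exact: dcontraction_continuous.
  have [l /cderiv_continuous cq] := quotient_deriv (near2 y) (contraction_neq y).
  by apply: (@continuous_comp _ _ _ contraction) cq; exact: contraction_continuous.
have hG (k : R) v y : G (k *: v) y = k%:C * G v y.
  by rewrite /G /dcontraction !(rmorphM (real_complex R)); ring.
have tri a h : triangle G a h = 0.
  apply: goursat => // p e e0.
  have [m dm] := quotient_deriv (near2 p) (contraction_neq p).
  apply: (@exact_of_C1 _ contraction dcontraction quotient G p 1 m ltr01 _ _ _
    dm e e0).
  - by move=> v; exact: dcontraction_continuous.
  - by move=> y v _ _; exact: vderiv_contraction.
  - by [].
have := square_edges cG hG tri.
have -> : edge G 0 (ex R) = edge G (ey R) (ex R).
  apply: eq_cint => t _; rewrite /G /contraction /dcontraction /=.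
  rewrite /GRing.scale /= !(mulr0, addr0, add0r, mulr1).
  by rewrite (circle_closed z0 r) !mul0r !addr0.
rewrite addrC => /addIr h; rewrite /edge in h.
transitivity (cint (fun t => G (ey R) (0 + t *: ey R))).
  apply: eq_cint => t _; rewrite /G /contraction /dcontraction /=.
  rewrite /GRing.scale /= !(mulr0, addr0, add0r, mulr1, mul0r, mul1r).
  by rewrite /shrink expr0n mulr0 addr0 invr1 rmorph1 !mul1r [z + _]addrC subrK.
rewrite -h; apply: eq_cint => t _; rewrite /G /contraction /dcontraction /=.
by rewrite /GRing.scale /= !(mulr0, addr0, add0r, mulr1, mul0r, mul1r).
Qed.

End Homotopy.

(** The difference quotient stays bounded near [z], while the length of the contracted circle tends
    to 0. *)
Lemma cauchy_quotient z : modulus (z - z0) < r ->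
  cint (fun t => quotient z (circle t) * circle' t) = 0.
Proof.
move=> zr; have [|l fl] := f_holo (z := z).
  by rewrite (lt_trans zr)// mulr_natl mulr2n ltrDl.
have [d d0 lip] := has_deriv_lip fl.
apply/eqP; rewrite -modulus_eq0 eq_le modulus_ge0 andbT.
apply/ler_addgt0Pl => e e0; rewrite addr0.
pose M := 2 * ((modulus l + 1) * (2 * pi * r)).
have l1 : 0 < modulus l + 1 by rewrite ltr_wpDl// modulus_ge0.
have M0 : 0 < M by rewrite !mulr_gt0// pi_gt0.
(* Ratio of the contraction: at most 1 so that [c] = 1 / a - 1 is nonnegative, at most [e / M] for
   the final bound, and at most [d / (4 * r)] so that the contracted circle lies where the Lipschitz
   bound holds. *)
pose a := Num.min 1 (Num.min (e / M) (d / (4 * r))).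
have a0 : 0 < a by rewrite !lt_min ltr01 !divr_gt0// mulr_gt0.
have c0 : 0 <= a^-1 - 1 by rewrite subr_ge0 invf_ge1// ge_min lexx.
have sa : shrink (a^-1 - 1) 1 = a.
  by rewrite /shrink expr1n mulr1 addrC subrK invrK.
have far (t : R) : z + a%:C * (circle t - z) - z = a%:C * (circle t - z).
  by rewrite addrC addKr.
have cq : continuous (fun t => quotient z (z + a%:C * (circle t - z)) *
    (a%:C * circle' t)).
  move=> t; apply: cvgM; last first.
    by apply: continuous_cmul; exact: circle'_continuous.
  have [||m /cderiv_continuous cm] :=
    quotient_deriv (z := z) (x := z + a%:C * (circle t - z)).
  - have := contraction_near zr c0 (1, t).
    rewrite /contraction /= sa => /le_lt_trans; apply.
    by rewrite mulr_natl mulr2n ltrDl.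
  - have := contraction_neq zr c0 (1, t).
    by rewrite /contraction /= sa.
  apply: (@continuous_comp _ _ _ (fun t => z + a%:C * (circle t - z))) cm.
  apply: cvgD; first exact: cvg_cst.
  apply: cvgM; first exact: cvg_cst.
  by apply: cvgB; [exact: circle_continuous|exact: cvg_cst].
rewrite (contraction_homotopy zr c0) sa.
apply: le_trans (le_modulus_cint (M := (modulus l + 1) * (a * (2 * pi * r))) cq _) _.
  move=> t _; rewrite modulusM [modulus (a%:C * _)]modulusM modulus_circle'//.
  rewrite modulus_real (gtr0_norm a0) ler_wpM2r ?mulr_ge0 ?(ltW a0) ?pi_ge0 ?(ltW r0)//.
  have ct : 0 < modulus (circle t - z) by rewrite modulus_gt0 circle_neq.
  rewrite /quotient far modulusM modulusV [modulus (a%:C * _)]modulusM.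
  rewrite modulus_real (gtr0_norm a0).
  rewrite ler_pdivrMr ?mulr_gt0//.
  have := lip (a%:C * (circle t - z)).
  rewrite /= modulusM modulus_real (gtr0_norm a0); apply.
  have : a <= d / (4 * r) by rewrite !ge_min lexx !orbT.
  rewrite ler_pdivlMr ?mulr_gt0// => ad; apply: lt_le_trans ad.
  rewrite ltr_pM2l//.
  have -> : circle t - z = (circle t - z0) - (z - z0) by ring.
  apply: le_lt_trans (modulusD _ _) _; rewrite modulus_circle// modulusN.
  by move: zr r0; lra.
have : a <= e / M by rewrite !ge_min lexx !orbT.
rewrite ler_pdivlMr// => h; apply: le_trans h; rewrite /M.
by rewrite le_eqVlt; apply/orP; left; apply/eqP; ring.
Qed.

(** The winding integral stays as a factor instead of being evaluated to 2 pi i; later arguments use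
    its zero derivative and its value at the centre. *)
Lemma cauchy_formula z : modulus (z - z0) < r ->
  cint (fun t => (f (circle t) * circle' t) * (circle t - z)^-1) =
  f z * cint (fun t => circle' t * (circle t - z)^-1).
Proof.
move=> zr.
have cc : continuous (fun t => (circle t - z)^-1).
  move=> t; have /cderiv_continuous ci := cderiv_inv (circle_neq r0 t zr).
  apply: (@continuous_comp _ _ _ (fun t => circle t - z)) ci.
  by apply: cvgB; [exact: circle_continuous|exact: cvg_cst].
have c1 : continuous (fun t => circle' t * (circle t - z)^-1).
  by move=> t; apply: cvgM; [exact: circle'_continuous|exact: cc].
have cf : continuous (fun t => f (circle t)).
  move=> t; have [|l /cderiv_continuous cl] := f_holo (z := circle t).
    by rewrite modulus_circle// mulr_natl mulr2n ltrDl.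
  by apply: (@continuous_comp _ _ _ circle) cl; exact: circle_continuous.
have c2 : continuous (fun t => (f (circle t) * circle' t) * (circle t - z)^-1).
  move=> t; apply: cvgM; last exact: cc.
  by apply: cvgM; [exact: cf|exact: circle'_continuous].
have := cauchy_quotient zr.
have -> : (fun t => quotient z (circle t) * circle' t) = (fun t =>
    f (circle t) * circle' t * (circle t - z)^-1 +
    (- f z) * (circle' t * (circle t - z)^-1)).
  by apply/funext => t; rewrite /quotient; ring.
rewrite (cintD c2 (continuous_cmul c1)) (cintZ _ c1) mulNr => /eqP.
by rewrite subr_eq0 => /eqP.
Qed.

End CauchyFormula.

(** * Differentiation of Cauchy integrals and holomorphy of the derivative *)

Section DerivativeHolomorphic.
Variable R : realType.
Local Notation C := (Cplx R).

Lemma continuous_bounded (F : R -> C) : continuous F ->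
  exists M : R, forall t : R, 0 <= t <= 1 -> modulus (F t) <= M.
Proof.
move=> cF; pose h (t : R) := `|complex.Re (F t)| + `|complex.Im (F t)|.
have ch : {within `[0, 1], continuous h}.
  apply: continuous_subspaceT => t; apply: cvgD; apply: cvg_norm.
    exact: continuous_Re cF t.
  exact: continuous_Im cF t.
have [c _ hc] := EVT_max ler01 ch; exists (h c) => t t01.
by apply: le_trans (modulus_le_ReIm _) _; apply: hc; rewrite in_itv.
Qed.

(** Differentiation under the integral sign: a remainder quadratic in [h], uniformly in [t],
    survives integration. *)
Lemma cderiv_cint (F : R -> C -> C) (F' : R -> C) (z : C) (d K : R) : 0 < d ->
  (forall h, modulus h < d -> continuous (fun t => F t (z + h))) ->
  continuous F' ->
  (forall t h, 0 <= t <= 1 -> modulus h < d ->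
     modulus (F t (z + h) - F t z - F' t * h) <= K * modulus h ^+ 2) ->
  cderiv (fun x => cint (fun t => F t x)) z (cint F').
Proof.
move=> d0 cF cF' H; apply: (@has_derivI _ _ _ (2 * `|K|)) => e e0 _.
exists (Num.min d e) => [|h /=]; first by rewrite lt_min d0.
rewrite lt_min => /andP[hd he].
have cFh := cF h hd.
have c0 : continuous (fun t => F t z).
  by have := cF 0; rewrite modulus0 addr0; apply.
have cd : continuous (fun t => F t (z + h) + (-1 * F t z + - h * F' t)).
  move=> t; apply: cvgD; first exact: cFh.
  by apply: cvgD; [exact: (continuous_cmul c0)|exact: (continuous_cmul cF')].
have -> : cint (fun t => F t (z + h)) - cint (fun t => F t z) - cint F' * h =
    cint (fun t => F t (z + h) + (-1 * F t z + - h * F' t)).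
  have c1 : continuous (fun t => -1 * F t z + - h * F' t).
    by move=> t; apply: cvgD; [exact: (continuous_cmul c0)|exact: (continuous_cmul cF')].
  rewrite (cintD cFh c1) (cintD (continuous_cmul c0) (continuous_cmul cF')).
  by rewrite (cintZ _ c0) (cintZ _ cF'); ring.
apply: le_trans (le_modulus_cint (M := `|K| * (modulus h ^+ 2)) cd _) _.
  move=> t t01.
  have -> : F t (z + h) + (-1 * F t z + - h * F' t) =
    F t (z + h) - F t z - F' t * h by ring.
  apply: le_trans (H _ _ t01 hd) _.
  by rewrite ler_wpM2r ?exprn_ge0 ?modulus_ge0// ler_norm.
rewrite -!mulrA ler_wpM2l// ler_wpM2l// expr2 ler_wpM2r ?modulus_ge0//.
exact: ltW.
Qed.

Lemma modulus_nat n : modulus (n%:R : C) = n%:R.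
Proof. by rewrite -(rmorph_nat (real_complex R)) modulus_real ger0_norm. Qed.

(** The remainder is k^2 / (u^2 (u - k)), with |u - k| >= m / 2. *)
Lemma inv_taylor (u k : C) (m : R) : 0 < m -> m <= modulus u -> modulus k <= m / 2 ->
  modulus ((u - k)^-1 - u^-1 - (u ^+ 2)^-1 * k) <= 2 / m ^+ 3 * modulus k ^+ 2.
Proof.
move=> m0 mu km.
have uk : m / 2 <= modulus (u - k) by have := ler_modulusB u k; lra.
have m20 : 0 < m / 2 by rewrite divr_gt0.
have u0 : u != 0 by rewrite -modulus_gt0 (lt_le_trans m0).
have uk0 : u - k != 0 by rewrite -modulus_gt0 (lt_le_trans m20).
have -> : (u - k)^-1 - u^-1 - (u ^+ 2)^-1 * k = (u ^+ 2)^-1 * (u - k)^-1 * k ^+ 2.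
  by field; rewrite uk0 u0.
rewrite modulusM [modulus (k ^+ 2)]modulusX ler_wpM2r ?exprn_ge0 ?modulus_ge0//.
rewrite modulusM !modulusV modulusX.
have -> : 2 / m ^+ 3 = (m ^+ 2)^-1 * (m / 2)^-1 by field; rewrite gt_eqF.
apply: ler_pM; rewrite ?invr_ge0 ?exprn_ge0 ?modulus_ge0//.
  rewrite lef_pV2 ?posrE ?exprn_gt0// ?(lt_le_trans m0)//.
  by rewrite ler_pXn2r// nnegrE ltW// (lt_le_trans m0).
by rewrite lef_pV2 ?posrE// (lt_le_trans m20).
Qed.

(** The remainder is k^2 (3 u - 2 k) / (u^3 (u - k)^2). Here |3 u - 2 k| <= 4 |u|, and (m / 2)^-2
    contributes another 4, so 16 in all. *)
Lemma inv_sqr_taylor (u k : C) (m : R) :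
  0 < m -> m <= modulus u -> modulus k <= m / 2 ->
  modulus ((u - k)^-1 ^+ 2 - u^-1 ^+ 2 - 2 * (u ^+ 3)^-1 * k) <=
  16 / m ^+ 4 * modulus k ^+ 2.
Proof.
move=> m0 mu km.
have uk : m / 2 <= modulus (u - k) by have := ler_modulusB u k; lra.
have m20 : 0 < m / 2 by rewrite divr_gt0.
have u0 : u != 0 by rewrite -modulus_gt0 (lt_le_trans m0).
have uk0 : u - k != 0 by rewrite -modulus_gt0 (lt_le_trans m20).
have mu0 : 0 < modulus u by rewrite (lt_le_trans m0).
have -> : (u - k)^-1 ^+ 2 - u^-1 ^+ 2 - 2 * (u ^+ 3)^-1 * k =
    ((3 * u - 2 * k) / u) * ((u ^+ 2)^-1 * ((u - k) ^+ 2)^-1) * k ^+ 2.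
  by field; rewrite uk0 u0.
rewrite [X in X <= _]modulusM [modulus (k ^+ 2)]modulusX.
rewrite ler_wpM2r ?exprn_ge0 ?modulus_ge0// modulusM.
have -> : 16 / m ^+ 4 = 4 * ((m ^+ 2)^-1 * ((m / 2) ^+ 2)^-1).
  by field; rewrite gt_eqF.
apply: ler_pM; rewrite ?modulus_ge0//.
  rewrite modulusM modulusV ler_pdivrMr//.
  rewrite (le_trans (modulusD _ _))// modulusN !modulusM.
  by rewrite !modulus_nat; lra.
rewrite modulusM !modulusV !modulusX.
apply: ler_pM; rewrite ?invr_ge0 ?exprn_ge0 ?modulus_ge0//.
  rewrite lef_pV2 ?posrE ?exprn_gt0//.
  by rewrite ler_pXn2r// nnegrE ltW.
rewrite lef_pV2 ?posrE ?exprn_gt0// ?(lt_le_trans m20)//.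
by rewrite ler_pXn2r// nnegrE ltW// (lt_le_trans m20).
Qed.

Variables (z0 : C) (r : R).
Hypothesis r0 : 0 < r.
Local Notation circle := (circle z0 r).

(** [h] includes the factor [circle'], so one family contains the Cauchy integral of [f], the
    winding integral and their first derivatives. *)
Definition cauchy_int (n : nat) (h : R -> C) (z : C) : C :=
  cint (fun t => h t * (circle t - z)^-1 ^+ n).

Lemma cauchy_continuous n (h : R -> C) z : continuous h -> modulus (z - z0) < r ->
  continuous (fun t => h t * (circle t - z)^-1 ^+ n).
Proof.
move=> ch zr t; apply: cvgM; first exact: ch.
have ci : {for t, continuous (fun t => (circle t - z)^-1)}.
  have /cderiv_continuous ci := cderiv_inv (circle_neq r0 t zr).
  apply: (@continuous_comp _ _ _ (fun t => circle t - z)) ci.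
  by apply: cvgB; [exact: circle_continuous|exact: cvg_cst].
elim: n => [|n IH]; first exact: cvg_cst.
rewrite (_ : (fun t => _) = fun t => (circle t - z)^-1 * (circle t - z)^-1 ^+ n).
  by rewrite exprS; exact: cvgM ci IH.
by apply/funext => s; rewrite exprS.
Qed.

Lemma cauchy_radius z h : modulus (z - z0) < r ->
  modulus h < (r - modulus (z - z0)) / 2 -> modulus (z + h - z0) < r.
Proof.
move=> zr hr; rewrite addrAC; apply: le_lt_trans (modulusD _ _) _.
by move: zr hr; lra.
Qed.

Lemma cderiv_cauchy1 h z : continuous h -> modulus (z - z0) < r ->
  cderiv (cauchy_int 1 h) z (cauchy_int 2 h z).
Proof.
move=> ch zr; have [M HM] := continuous_bounded ch.
pose m := r - modulus (z - z0); have m0 : 0 < m by rewrite subr_gt0.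
apply: (@cderiv_cint (fun t z => h t * (circle t - z)^-1 ^+ 1) _ z (m / 2)
  (M * (2 / m ^+ 3))); first by rewrite divr_gt0.
- by move=> k km; apply: cauchy_continuous => //; exact: cauchy_radius.
- exact: cauchy_continuous.
move=> t k t01 km.
have := inv_taylor m0 (circle_far z0 r0 z t) (ltW km).
have -> : h t * (circle t - (z + k))^-1 ^+ 1 - h t * (circle t - z)^-1 ^+ 1 -
    h t * (circle t - z)^-1 ^+ 2 * k = h t *
    ((circle t - z - k)^-1 - (circle t - z)^-1 - ((circle t - z) ^+ 2)^-1 * k).
  by rewrite !expr1 opprD addrA -exprVn; ring.
move=> H; rewrite modulusM -[leRHS]mulrA.
by apply: ler_pM; rewrite ?modulus_ge0 ?HM.
Qed.

Lemma cderiv_cauchy2 h z : continuous h -> modulus (z - z0) < r ->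
  exists l, cderiv (cauchy_int 2 h) z l.
Proof.
move=> ch zr; have [M HM] := continuous_bounded ch.
pose m := r - modulus (z - z0); have m0 : 0 < m by rewrite subr_gt0.
exists (cint (fun t => 2 * (h t * (circle t - z)^-1 ^+ 3))).
apply: (@cderiv_cint (fun t z => h t * (circle t - z)^-1 ^+ 2) _ z (m / 2)
  (M * (16 / m ^+ 4))); first by rewrite divr_gt0.
- by move=> k km; apply: cauchy_continuous => //; exact: cauchy_radius.
- by apply: continuous_cmul; exact: cauchy_continuous.
move=> t k t01 km.
have := inv_sqr_taylor m0 (circle_far z0 r0 z t) (ltW km).
have -> : h t * (circle t - (z + k))^-1 ^+ 2 - h t * (circle t - z)^-1 ^+ 2 -
    2 * (h t * (circle t - z)^-1 ^+ 3) * k = h t *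
    ((circle t - z - k)^-1 ^+ 2 - (circle t - z)^-1 ^+ 2 -
     2 * ((circle t - z) ^+ 3)^-1 * k).
  by rewrite opprD addrA -[((circle t - z) ^+ 3)^-1]exprVn; ring.
move=> H; rewrite modulusM -[leRHS]mulrA.
by apply: ler_pM; rewrite ?modulus_ge0 ?HM.
Qed.

(** The integrand has the primitive -1 / (x - z) along a closed curve. *)
Lemma winding_deriv0 z : modulus (z - z0) < r -> cauchy_int 2 (circle' r) z = 0.
Proof.
move=> zr; have cc := cauchy_continuous (n := 2) (circle'_continuous (r := r)) zr.
rewrite /cauchy_int (cint_FTC (P := fun t => - (circle t - z)^-1) cc).
  by rewrite (circle_closed z0 r) subrr.
move=> t _.
have d1 := has_derivB (vderiv_circle z0 r t) (has_deriv_cst _ z t).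
have := has_derivN (has_deriv_comp d1 (cderiv_inv (circle_neq r0 t zr))).
congr (vderiv _ _ _).
by rewrite subr0 mulNr opprK mulrC exprVn.
Qed.

(** At the centre the integrand is the constant 2 pi i. *)
Lemma winding_center : cauchy_int 1 (circle' r) z0 != 0.
Proof.
have -> : cauchy_int 1 (circle' r) z0 = cint (fun=> (2 * pi)%:C * (0 +i* 1)).
  apply: eq_cint => t _; rewrite expr1 /circle /circle' addrC.
  have c0 : cis (2 * pi * t + 0) != 0 :> C.
    by rewrite -modulus_gt0 modulus_cis.
  have rr : r%:C != 0 :> C by rewrite -modulus_gt0 modulus_real gtr0_norm.
  rewrite addrC addrAC subrr add0r; field; by rewrite c0.
have cc : continuous (fun _ : R => (2 * pi)%:C * (0 +i* 1) : C).
  by move=> t; exact: cvg_cst.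
rewrite (cint_FTC (P := fun t => (2 * pi)%:C * (0 +i* 1) * t%:C) cc).
  rewrite rmorph1 rmorph0 mulr0 subr0 mulr1 -modulus_gt0 modulusM modulus_i.
  by rewrite modulus_real mulr1 normr_gt0 mulf_neq0// gt_eqF// pi_gt0.
move=> t _; have := has_derivZ ((2 * pi)%:C * (0 +i* 1))
  (has_deriv_incl (real_complex R) t).
by rewrite mulr1.
Qed.

End DerivativeHolomorphic.

(** Near [z0] the function is the quotient of its Cauchy integral by the winding integral [W]. As
    [W] has derivative 0 and does not vanish there, the derivative is again a Cauchy-type integral
    over [W], hence differentiable. *)
Theorem derive1_holomorphic (R : realType) (f : Cplx R -> Cplx R) (z0 : Cplx R)
    (d : R) : 0 < d ->
  (forall z, modulus (z - z0) < d -> exists l, cderiv f z l) ->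
  exists l, cderiv (derive1 f) z0 l.
Proof.
move=> d0 hf; pose r := d / 2; have r0 : 0 < r by rewrite divr_gt0.
have d2r : d = 2 * r by rewrite /r mulrC divfK.
rewrite d2r in hf.
have zz : modulus (z0 - z0) < r by rewrite subrr modulus0.
pose W := cauchy_int z0 r 1 (circle' r).
pose h t := f (circle z0 r t) * circle' r t.
have ch : continuous h.
  move=> t; apply: cvgM; last exact: circle'_continuous.
  have [|l /cderiv_continuous cl] := hf (circle z0 r t).
    by rewrite modulus_circle// mulr_natl mulr2n ltrDl.
  by apply: (@continuous_comp _ _ _ (circle z0 r)) cl; exact: circle_continuous.
have cc := circle'_continuous (r := r).
have dW z : modulus (z - z0) < r -> cderiv W z 0.
  by move=> zr; rewrite -(winding_deriv0 r0 zr); exact: cderiv_cauchy1.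
have fW z : modulus (z - z0) < r -> f z * W z = cauchy_int z0 r 1 h z.
  move=> zr; have := cauchy_formula r0 hf zr => E.
  rewrite /W /cauchy_int; under [in RHS]eq_fun do rewrite expr1.
  by under [in LHS]eq_fun do rewrite expr1.
have W0 : W z0 != 0 by exact: winding_center.
(* Staying within half of |W z0| of [W z0] keeps [W] away from 0. *)
have mW0 : 0 < modulus (W z0) / 2 by rewrite divr_gt0// modulus_gt0.
have [e e0 We] := has_deriv_cont (dW _ zz) mW0.
pose b := Num.min e r; have b0 : 0 < b by rewrite lt_min e0.
have Wn z : modulus (z - z0) < b -> W z != 0.
  rewrite lt_min => /andP[ze _]; apply/eqP => Wz0.
  have := We (z - z0) ze; rewrite [z0 + _]addrC subrK Wz0 sub0r modulusN.
  by move: mW0; lra.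
have df z : modulus (z - z0) < b ->
    cderiv f z (cauchy_int z0 r 2 h z * (W z)^-1).
  move=> zb; have zr : modulus (z - z0) < r.
    by move: zb; rewrite lt_min => /andP[].
  have dK := cderiv_cauchy1 r0 ch zr.
  have dV := has_deriv_comp (dW _ zr) (cderiv_inv (Wn _ zb)).
  have := has_derivM dK dV; rewrite mulr0 mulr0 addr0.
  apply: (@has_deriv_near _ _ _ _ _ _ _ (b - modulus (z - z0))).
    by rewrite subr_gt0.
  move=> k /=; rewrite ltrBrDl => kb.
  have zk : modulus (z + k - z0) < b.
    by apply: le_lt_trans kb; rewrite addrAC; exact: modulusD.
  have zkr : modulus (z + k - z0) < r by move: zk; rewrite lt_min => /andP[].
  by rewrite -fW// mulfK// Wn.
have zb : modulus (z0 - z0) < b by rewrite subrr modulus0.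
have [l dl] := cderiv_cauchy2 r0 ch zz.
have dV := has_deriv_comp (dW _ zz) (cderiv_inv W0).
eexists; apply: has_deriv_near b0 _ (has_derivM dl dV) => k /= kb.
have /df/cderivP[_ ->//] : modulus (z0 + k - z0) < b by rewrite addrAC subrr add0r.
Qed.

(** * Pullbacks and integrals over chains *)

Section Pullback.
Variable R : realType.
Local Notation C := (Cplx R).

Lemma pullback_holomorphic (S T : riemann_surface R) (r : S -> T) (w : T -> C) :
  holomorphic r -> holomorphic_form w -> holomorphic_form (pullback r w).
Proof.
move=> hr hw p x px; have qx := dom_center (r x).
have [d d0 near] := chart_nbhs px (nbhs_preimage hr.1 qx).
have dg z : modulus (z - chart p x) < d ->
    exists l, cderiv (local_map r p (r x)) z l.
  move=> /near[pz Ez qz]; exists (derive1 (local_map r p (r x)) z).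
  by rewrite -Ez; exact: local_map_deriv.
have [l dl] := derive1_holomorphic d0 dg.
have [m dm] := form_coef_deriv hw qx; rewrite -(local_mapE r _ px) in dm.
have dgx := local_map_deriv hr px qx.
have := has_derivM (has_deriv_comp dgx dm) dl.
set l' := (_ + _) => dp.
suff /cderivP[] : cderiv (form_coef (pullback r w) p) (chart p x) l' by [].
apply: has_deriv_near d0 _ dp => h /= hd.
have [|pz Ez qz] := near (chart p x + h); first by rewrite addrC addKr.
by rewrite -Ez (form_coef_pullback w hr pz qz).
Qed.

Lemma path_integrand_continuous (S : riemann_surface R) (w : S -> C) g :
  holomorphic_form w -> C1_map g -> continuous (path_integrand w g).
Proof.
by move=> hw cg; rewrite path_integrand_along; exact: form_along_continuous.
Qed.

Lemma path_integrand_pullback (S T : riemann_surface R) (r : S -> T)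
    (w : T -> C) (g : R -> S) : holomorphic r -> C1_map g ->
  path_integrand (pullback r w) g = path_integrand w (r \o g).
Proof.
move=> hr cg; apply/funext => t; have pt := dom_center (g t).
have [/(_ 1)[dr _] /(_ 1)[di _]] := cg.2 _ _ pt.
apply: (pullback_velocity w hr (cg.1 t) pt (l := velocity (g t) g t)).
by apply/vderivP; split; [exact: dr|exact: di|].
Qed.

End Pullback.

(** * Integration over singular chains and invariance under homology *)

Section ChainIntegral.
Variables (R : realType) (S : riemann_surface R).
Local Notation C := (Cplx R).
Local Notation I := {t : R | (0 <= t <= 1)%R}.
Local Notation mu := (@lebesgue_measure R).

(** Turns a function on [[0, 1]] into a curve on [R], as a velocity requires; values outside the
    interval are arbitrary. *)
Definition clamp (t : R) : I := insubd (exist _ 0 (introT andP (conj (lexx 0) ler01))) t.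

Lemma val_clamp t : 0 <= t <= 1 -> val (clamp t) = t.
Proof. by move=> t01; rewrite val_insubd t01. Qed.

(* The open interval is used because the velocity of the extended curve at 0 and 1
   does not only depend on the restriction of the curve to [0, 1]. *)
Definition simplex_integral (w : S -> C) (g : I -> S) : C :=
  let F := path_integrand w (g \o clamp) in
  (\int[mu]_(t in `]0, 1[) complex.Re (F t)) +i*
  (\int[mu]_(t in `]0, 1[) complex.Im (F t)).

(** A velocity is a local notion, and near an interior point [clamp] is the identity; the endpoints
    have measure zero. *)
Lemma simplex_integralE w (g : R -> S) : continuous (path_integrand w g) ->
  simplex_integral w (fun t => g (val t)) = path_integral w g.
Proof.
move=> cF; rewrite path_integralE; apply: (cint_open cF) => t /andP[t0 t1].
have near : \forall u \near t, val (clamp u) = u.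
  have : \forall u \near t, u \in `]0, 1[.
    by apply: near_in_itvoo; rewrite in_itv /= t0 t1.
  apply: filterS => u; rewrite in_itv /= => /andP[u0 u1].
  by rewrite val_clamp// !ltW.
have tt : val (clamp t) = t by rewrite val_clamp// !ltW.
rewrite /path_integrand /= tt; congr (_ * _); rewrite /velocity.
have E (f : S -> R) : derive1 (fun u => f (g (val (clamp u)))) t =
    derive1 (fun u => f (g u)) t.
  rewrite !derive1E; apply: near_eq_derive; apply: filterS near => u /= uu.
  by rewrite [val _]uu.
by rewrite (E (fun x => complex.Re (chart (g t) x)))
  (E (fun x => complex.Im (chart (g t) x))).
Qed.

Definition chain_integral (w : S -> C) : chain S -> C :=
  fglift (simplex_integral w : _ -> zmodule C).

Lemma chain_integralB w x y :
  chain_integral w (x - y) = chain_integral w x - chain_integral w y.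
Proof. exact: (@lift_is_additive _ _ (zmodule C)). Qed.

Lemma chain_integral0 w : chain_integral w 0 = 0.
Proof. by rewrite -(subrr (0 : chain S)) chain_integralB subrr. Qed.

Lemma chain_integralN w x : chain_integral w (- x) = - chain_integral w x.
Proof. by rewrite -sub0r chain_integralB chain_integral0 sub0r. Qed.

Lemma chain_integralD w x y :
  chain_integral w (x + y) = chain_integral w x + chain_integral w y.
Proof. by rewrite -{1}(opprK y) chain_integralB chain_integralN opprK. Qed.

Lemma chain_integral_sum w n (F : 'I_n -> chain S) :
  chain_integral w (\sum_(i < n) F i) = \sum_(i < n) chain_integral w (F i).
Proof.
exact: (big_morph _ (chain_integralD w) (chain_integral0 w)).
Qed.

Lemma chain_integralMz w x (k : int) :
  chain_integral w (x *~ k) = chain_integral w x *~ k.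
Proof.
have Mn n : chain_integral w (x *+ n) = chain_integral w x *+ n.
  elim: n => [|n IH]; first by rewrite !mulr0n chain_integral0.
  by rewrite !mulrS chain_integralD IH.
case: k => n; first by rewrite -!pmulrn Mn.
by rewrite NegzE !mulrNz chain_integralN -!pmulrn Mn.
Qed.

Lemma chain_integral_simplex w (g : R -> S) : continuous (path_integrand w g) ->
  chain_integral w (simplex g) = path_integral w g.
Proof.
move=> cF; rewrite /chain_integral /simplex liftU -simplex_integralE//.
Qed.

Lemma chain_integral_boundary w (sigma : (R * R)%type -> S) :
  holomorphic_form w -> C1_map sigma ->
  chain_integral w (triangle_boundary sigma) = 0.
Proof.
move=> hw cs; rewrite /triangle_boundary chain_integralD chain_integralB.
have line (a v : R * R) : continuous (path_integrand w (fun t => sigma (a + t *: v))).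
  rewrite path_integrand_line.
  exact: edge_continuous (form_along_continuous hw cs) _ _ _.
rewrite !chain_integral_simplex; first exact: integral_triangle_boundary.
- rewrite (_ : (fun t => _) = fun t => sigma (0 + t *: ex R)); first exact: line.
  by apply/funext => t; congr sigma; vec_ring.
- rewrite (_ : (fun t => _) = fun t => sigma (0 + t *: ey R)); first exact: line.
  by apply/funext => t; congr sigma; vec_ring.
- rewrite (_ : (fun t => _) = fun t => sigma (ex R + t *: (ey R - ex R))).
    exact: line.
  by apply/funext => t; congr sigma; vec_ring.
Qed.

Lemma chain_integral_homologous w x y : holomorphic_form w ->
  homologous x y -> chain_integral w x = chain_integral w y.
Proof.
move=> hw [n [k [sigma [cs E]]]]; apply/eqP; rewrite -subr_eq0 -chain_integralB.
rewrite E chain_integral_sum big1// => i _.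
by rewrite chain_integralMz chain_integral_boundary// mul0rz.
Qed.

End ChainIntegral.

(** * Changes of symplectic basis *)

Section Cycles.
Variables (R : realType) (S : riemann_surface R).
Local Notation cycle := (@singular_cycle R S).

Lemma cycle_simplex (g : R -> S) : closed_curve g -> cycle (simplex g).
Proof.
move=> [cg per]; exists 1, (fun=> 1), (fun=> g); split => //.
  by rewrite big_ord1.
by rewrite big_ord1 -[X in g X]add0r per subrr mul0rz.
Qed.

Lemma cycleMz x (k : int) : cycle x -> cycle (x *~ k).
Proof.
move=> [n [l [g [cg -> E]]]]; exists n, (fun i => l i * k), g; split => //.
  by rewrite mulrz_suml; apply: eq_bigr => i _; rewrite mulrzA.
transitivity ((\sum_(i < n) (<< g i 1 >> - << g i 0 >>) *~ l i) *~ k :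
    {freeg S / int}); last by rewrite E mul0rz.
by rewrite mulrz_suml; apply: eq_bigr => i _; rewrite mulrzA.
Qed.

Lemma cycleD x y : cycle x -> cycle y -> cycle (x + y).
Proof.
move=> [n [l [g [cg -> E]]]] [n' [l' [g' [cg' -> E']]]].
pose L (i : 'I_(n + n')) :=
  match fintype.split i with inl j => l j | inr j => l' j end.
pose G (i : 'I_(n + n')) :=
  match fintype.split i with inl j => g j | inr j => g' j end.
have Ll j : L (lshift n' j) = l j by rewrite /L (unsplitK (inl j)).
have Lr j : L (rshift n j) = l' j by rewrite /L (unsplitK (inr j)).
have Gl j : G (lshift n' j) = g j by rewrite /G (unsplitK (inl j)).
have Gr j : G (rshift n j) = g' j by rewrite /G (unsplitK (inr j)).
exists (n + n')%N, L, G; split.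
- by move=> i; rewrite /G; case: fintype.split.
- by rewrite big_split_ord /=; congr (_ + _); apply: eq_bigr => j _;
    rewrite ?Ll ?Lr ?Gl ?Gr.
rewrite big_split_ord /= -[RHS](addr0 0).
by congr (_ + _); [rewrite -[RHS]E|rewrite -[RHS]E'];
  apply: eq_bigr => j _; rewrite ?Ll ?Lr ?Gl ?Gr.
Qed.

Lemma cycle_sum n (F : 'I_n.+1 -> chain S) :
  (forall i, cycle (F i)) -> cycle (\sum_(i < n.+1) F i).
Proof.
elim: n F => [|n IH] F cF; first by rewrite big_ord1.
by rewrite big_ord_recr /=; apply: cycleD => //; exact: IH.
Qed.

Variable b : chain S -> chain S -> int.
Hypothesis b_inter : intersection_form b.

Lemma inter_sym x y : cycle x -> cycle y -> b y x = - b x y.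
Proof. by case: b_inter => _ H _ _; exact: H. Qed.

Lemma interDl x x' y : cycle x -> cycle x' -> cycle y ->
  b (x + x') y = b x y + b x' y.
Proof. by case: b_inter => H _ _ _; exact: H. Qed.

(** Additivity of [b] is given on cycles, so each multiple entering the induction is first shown to
    be a cycle. *)
Lemma interMzl x y (k : int) : cycle x -> cycle y -> b (x *~ k) y = b x y * k.
Proof.
move=> cx cy.
have b0 : b (x *~ 0) y = 0.
  have c0 := cycleMz 0 cx; have := interDl c0 c0 cy.
  by rewrite -mulrzDr addr0 => /eqP; rewrite -subr_eq subrr eq_sym => /eqP.
have bn (n : nat) : b (x *~ n) y = b x y * n.
  elim: n => [|n IH]; first by rewrite b0 mulr0.
  rewrite intS mulrzDr mulr1z interDl//; last exact: cycleMz.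
  by rewrite IH mulrDr mulr1.
case: k => n; first exact: bn.
rewrite NegzE; have c1 := cycleMz n.+1 cx; have c2 := cycleMz (- n.+1%:Z) cx.
have := interDl c1 c2 cy; rewrite -mulrzDr subrr b0 bn => /esym/eqP.
by rewrite addrC addr_eq0 => /eqP ->; rewrite mulrN.
Qed.

Lemma inter_suml n (F : 'I_n.+1 -> chain S) (k : 'I_n.+1 -> int) y :
  (forall i, cycle (F i)) -> cycle y ->
  b (\sum_(i < n.+1) F i *~ k i) y = \sum_(i < n.+1) b (F i) y * k i.
Proof.
elim: n F k => [|n IH] F k cF cy; first by rewrite !big_ord1 interMzl.
rewrite !(big_ord_recr n.+1) /= interDl//; first by rewrite IH// interMzl.
  by apply: cycle_sum => i; exact: cycleMz.
exact: cycleMz.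
Qed.

Lemma inter_sumr n (F : 'I_n.+1 -> chain S) (k : 'I_n.+1 -> int) y :
  (forall i, cycle (F i)) -> cycle y ->
  b y (\sum_(i < n.+1) F i *~ k i) = \sum_(i < n.+1) b y (F i) * k i.
Proof.
move=> cF cy; rewrite inter_sym//; last by apply: cycle_sum => i; exact: cycleMz.
rewrite inter_suml// -sumrN; apply: eq_bigr => i _.
by rewrite -mulNr -inter_sym.
Qed.

Lemma inter_homologous x x' y y' : cycle x -> cycle x' -> cycle y -> cycle y' ->
  homologous x x' -> homologous y y' -> b x y = b x' y'.
Proof.
case: b_inter => _ _ H _ cx cx' cy cy' hx hy.
rewrite (H x x')// inter_sym// (H y y')// -inter_sym//.
Qed.

(** Expanding [c] in the classes of [d] turns the intersection matrix of [c] into N^T J N, and both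
    bases have intersection matrix J. The successor fits the sum lemmas, whose inductions start from
    one term. *)
Lemma symplectic_basis_change g (c d : 'I_(g.+1 + g.+1) -> R -> S) :
  symplectic_basis b c -> symplectic_basis b d ->
  exists N : 'M[int]_(g.+1 + g.+1), symplectic N /\ coordinates d c N.
Proof.
move=> [[cc _] bc] [[cd hd] bd].
have ccyc i := cycle_simplex (cc i); have dcyc i := cycle_simplex (cd i).
have /choice[n Hn] : forall j, exists n : 'rV[int]_(g.+1 + g.+1),
    homologous (simplex (c j)) (\sum_(i < _) simplex (d i) *~ n 0 i).
  by move=> j; have [n [Hn _]] := hd _ (ccyc j); exists n.
pose N : 'M[int]_(g.+1 + g.+1) := \matrix_(i, j) n j 0 i.
have HN : coordinates d c N.
  by move=> j; have := Hn j; congr homologous; apply: eq_bigr => i _; rewrite mxE.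
exists N; split => //; apply/matrixP => i j; rewrite -[RHS]bc.
have sc k : cycle (\sum_(l < g.+1 + g.+1) simplex (d l) *~ N l k).
  by apply: cycle_sum => l; exact: cycleMz.
rewrite (inter_homologous (ccyc i) (sc i) (ccyc j) (sc j) (HN i) (HN j)).
have El := @inter_suml (g + g.+1) (fun l => simplex (d l)) (fun l => N l i).
have Er := @inter_sumr (g + g.+1) (fun l => simplex (d l)) (fun l => N l j).
apply: etrans (esym (Er _ dcyc (sc i))); rewrite mxE; apply: eq_bigr => l _.
congr (_ * _); apply: etrans (esym (El _ dcyc (dcyc l))); rewrite mxE.
by apply: eq_bigr => k _; rewrite mxE bd mulrC.
Qed.

End Cycles.

(** * Periods *)

Section Periods.
Variables (R : realType) (S : riemann_surface R).
Local Notation C := (Cplx R).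

Lemma path_integral_sum n (w : 'I_n -> S -> C) (a : 'I_n -> C) (g : R -> S) :
  (forall i, holomorphic_form (w i)) -> C1_map g ->
  path_integral (fun x => \sum_(i < n) a i * w i x) g =
  \sum_(i < n) a i * path_integral (w i) g.
Proof.
move=> hw cg; rewrite path_integralE.
have -> : path_integrand (fun x => \sum_(i < n) a i * w i x) g =
    fun t => \sum_(i < n) a i * path_integrand (w i) g t.
  apply/funext => t; rewrite /path_integrand mulr_suml.
  by apply: eq_bigr => i _; rewrite mulrA.
by have [_ ->] := cint_sum a (fun i => path_integrand_continuous (hw i) cg).
Qed.

Lemma chain_integral_comb m (w : S -> C) (c : 'I_m -> R -> S) (k : 'I_m -> int) :
  holomorphic_form w -> (forall i, C1_map (c i)) ->
  chain_integral w (\sum_(i < m) simplex (c i) *~ k i) =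
  \sum_(i < m) path_integral w (c i) * (k i)%:~R.
Proof.
move=> hw cc; rewrite chain_integral_sum; apply: eq_bigr => i _.
rewrite chain_integralMz chain_integral_simplex ?mulrzr//.
exact: path_integrand_continuous.
Qed.

Definition periods g m (w : 'I_g -> S -> C) (c : 'I_m -> R -> S) : 'M[C]_(g, m) :=
  \matrix_(i, j) path_integral (w i) (c j).

Lemma periods_coordinates g m (w : 'I_g -> S -> C) (c d : 'I_m -> R -> S)
    (M : 'M[int]_m) :
  (forall i, holomorphic_form (w i)) ->
  (forall i, C1_map (c i)) -> (forall i, C1_map (d i)) -> coordinates d c M ->
  periods w c = periods w d *m map_mx intr M.
Proof.
move=> hw cc cd dc; apply/matrixP => i j; rewrite !mxE.
rewrite -chain_integral_simplex; last exact: path_integrand_continuous.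
rewrite (chain_integral_homologous (hw i) (dc j)) chain_integral_comb//.
by apply: eq_bigr => k _; rewrite !mxE.
Qed.

(** Row i of [A] holds the coordinates of the pullback of [w i]; its period over [c j] is that of
    [w i] over the image of [c j]. *)
Lemma periods_automorphism g m (w : 'I_g -> S -> C) (c : 'I_m -> R -> S)
    (f : S -> S) (M : 'M[int]_m) :
  form_basis w -> (forall i, C1_map (c i)) -> holomorphic f ->
  coordinates c (fun j => f \o c j) M ->
  exists A : 'M[C]_g, A *m periods w c = periods w c *m map_mx intr M.
Proof.
move=> [hw bw] cc hf fc.
have /choice[a Ha] : forall i, exists a : 'rV[C]_g, forall x,
    pullback f (w i) x = \sum_(j < g) a 0 j * w j x.
  by move=> i; have [a [Ha _]] := bw _ (pullback_holomorphic hf (hw i)); exists a.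
exists (\matrix_(i, j) a i 0 j); apply/matrixP => i j; rewrite !mxE.
transitivity (path_integral (pullback f (w i)) (c j)).
  have -> : pullback f (w i) = fun x => \sum_(j < g) a i 0 j * w j x.
    by apply/funext => x; rewrite Ha.
  by rewrite path_integral_sum//; apply: eq_bigr => k _; rewrite !mxE.
have cp := path_integrand_continuous (pullback_holomorphic hf (hw i)) (cc j).
rewrite path_integralE; rewrite path_integrand_pullback// in cp *.
rewrite -path_integralE -chain_integral_simplex//.
rewrite (chain_integral_homologous (hw i) (fc j)) chain_integral_comb//.
by apply: eq_bigr => k _; rewrite !mxE.
Qed.

End Periods.

(** * Riemann's bilinear relations and the symplectic action on the Siegel space *)

Section SymplecticAction.
Variables (R : realType) (g : nat).
Local Notation C := (Cplx R).
Implicit Types (Z : 'M[C]_g) (N : 'M[int]_(g + g)).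

(** The inverse in integral closed form, since J^-1 = -J. *)
Definition symplectic_inv N : 'M[int]_(g + g) :=
  - (J_std int g *m N^T *m J_std int g).

Lemma J_sqr (A : pzRingType) : J_std A g *m J_std A g = - 1%:M.
Proof.
rewrite /J_std mulmx_block !mul0mx !mulmx0 !addr0 !add0r !mul1mx !mulmx1.
by rewrite [in RHS]scalar_mx_block opp_block_mx !oppr0.
Qed.

Lemma map_J (A B : pzRingType) (f : {rmorphism A -> B}) :
  map_mx f (J_std A g) = J_std B g.
Proof. by rewrite /J_std map_block_mx map_mxN map_mx1 !map_mx0. Qed.

Lemma symplectic_mulV N : symplectic N -> symplectic_inv N *m N = 1%:M.
Proof.
move=> sN; rewrite /symplectic_inv mulNmx -!mulmxA (mulmxA N^T) sN.
by rewrite J_sqr opprK.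
Qed.

Lemma symplectic_tr N : symplectic N ->
  N *m J_std int g *m N^T = J_std int g.
Proof.
move=> sN; have := mulmx1C (symplectic_mulV sN).
rewrite /symplectic_inv mulmxN !mulmxA => /(congr1 (fun M => M *m J_std int g)).
by rewrite mul1mx mulNmx -(mulmxA _ (J_std int g)) J_sqr mulmxN mulmx1 opprK.
Qed.

Local Notation toC := (real_complex R).
Local Notation conjmx := (map_mx (@conjc R)).

Lemma conj_sub_Im Z : conjmx Z - Z = (- (2 * (0 +i* 1))) *: map_mx toC (map_mx (@complex.Im R) Z).
Proof.
apply/matrixP => i j; rewrite !mxE; case: (Z i j) => a b.
have -> : - (2 * (0 +i* 1)) * (complex.Im (a +i* b))%:C = - ((0 +i* b) + (0 +i* b)).
  rewrite mulNr -mulrA mulr_natl mulr2n; congr (- (_ + _)); simpc; by [].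
by simpc; congr (_ +i* _); ring.
Qed.

Lemma conj_sub_quadratic Z (v : 'rV[C]_g) (u : 'cV[C]_g) :
  v *m (conjmx Z - Z) *m u = (- (2 * (0 +i* 1))) *:
    (v *m map_mx toC (map_mx (@complex.Im R) Z) *m u).
Proof. by rewrite conj_sub_Im -scalemxAr -scalemxAl. Qed.

Lemma double_i_neq0 : - (2 * (0 +i* 1)) != 0 :> C.
Proof. by rewrite oppr_eq0 mulf_neq0 ?pnatr_eq0// -modulus_gt0 modulus_i. Qed.

(** For v = a + i b the cross terms between a and b are purely imaginary. *)
Lemma Re_quadratic (W : 'M[R]_g) (v : 'rV[C]_g) :
  complex.Re ((v *m map_mx toC W *m (conjmx v)^T) 0 0) =
  (map_mx (@complex.Re R) v *m W *m (map_mx (@complex.Re R) v)^T) 0 0 +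
  (map_mx (@complex.Im R) v *m W *m (map_mx (@complex.Im R) v)^T) 0 0.
Proof.
rewrite !mxE raddf_sum -big_split /=; apply: eq_bigr => j _.
rewrite !mxE !mulr_suml raddf_sum -big_split /=; apply: eq_bigr => i _.
rewrite !mxE; case: (v 0 i) => a b; case: (v 0 j) => a' b' /=.
by ring.
Qed.

Lemma siegel_quadratic_gt0 Z (v : 'rV[C]_g) : siegel Z -> v != 0 ->
  0 < complex.Re ((v *m map_mx toC (map_mx (@complex.Im R) Z) *m (conjmx v)^T) 0 0).
Proof.
move=> [_ pos] v0; rewrite Re_quadratic.
have ge0 (x : 'rV[R]_g) :
    0 <= (x *m map_mx (@complex.Im R) Z *m x^T) 0 0.
  have [->|x0] := eqVneq x 0; first by rewrite mul0mx mul0mx mxE.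
  have := pos x^T; rewrite trmxK => /(_ _)/ltW; apply.
  by rewrite -(inj_eq trmx_inj) trmxK trmx0.
have gt0 (x : 'rV[R]_g) : x != 0 ->
    0 < (x *m map_mx (@complex.Im R) Z *m x^T) 0 0.
  move=> x0; have := pos x^T; rewrite trmxK; apply.
  by rewrite -(inj_eq trmx_inj) trmxK trmx0.
have [re0|re0] := eqVneq (map_mx (@complex.Re R) v) 0; last first.
  by rewrite ltr_wpDr// gt0.
rewrite ltr_wpDl// gt0//; apply: contra v0 => /eqP im0; apply/eqP/rowP => i.
move/rowP/(_ i): re0; move/rowP/(_ i): im0; rewrite !mxE.
by case: (v 0 i) => a b /= -> ->.
Qed.

Section Action.
Variables (Z : 'M[C]_g) (N : 'M[int]_(g + g)) (X Y : 'M[C]_g).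
Hypotheses (sZ : siegel Z) (sN : symplectic N).
Local Notation NC := (map_mx intr N : 'M[C]_(g + g)).
Hypothesis period_mul : row_mx 1%:M Z *m NC = row_mx X Y.

Lemma symplectic_trC : NC *m J_std C g *m NC^T = J_std C g.
Proof.
have := congr1 (map_mx (intr : int -> C)) (symplectic_tr sN).
by rewrite !map_mxM map_trmx map_J.
Qed.

Lemma row_J (A B A' B' : 'M[C]_g) :
  row_mx A B *m J_std C g *m (row_mx A' B')^T = A *m B'^T - B *m A'^T.
Proof.
rewrite /J_std mul_row_block !mulmx0 add0r addr0 mulmxN !mulmx1.
by rewrite tr_row_mx mul_row_col mulNmx addrC.
Qed.

(** First bilinear relation: for (I Z) it is the symmetry of [Z], and N J N^T = J carries it over to
    (X Y). *)
Lemma riemann_equality : X *m Y^T = Y *m X^T.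
Proof.
apply/eqP; rewrite -subr_eq0 -row_J -period_mul trmx_mul -!mulmxA.
rewrite (mulmxA (J_std C g)) (mulmxA NC) (mulmxA NC) symplectic_trC mulmxA row_J.
by rewrite trmx1 mul1mx mulmx1 sZ.1 subrr.
Qed.

Lemma conj_int : conjmx NC = NC.
Proof. by apply/matrixP => i j; rewrite !mxE rmorph_int. Qed.

(** Second bilinear relation; its right side is -2i Im Z, where positivity enters. *)
Lemma riemann_inequality :
  X *m (conjmx Y)^T - Y *m (conjmx X)^T = conjmx Z - Z.
Proof.
have E : row_mx (conjmx X) (conjmx Y) = row_mx 1%:M (conjmx Z) *m NC.
  by rewrite -map_row_mx -period_mul map_mxM map_row_mx map_mx1 conj_int.
rewrite -row_J E -period_mul trmx_mul -!mulmxA.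
rewrite (mulmxA (J_std C g)) (mulmxA NC) (mulmxA NC) symplectic_trC mulmxA row_J.
by rewrite trmx1 mul1mx mulmx1 map_trmx sZ.1.
Qed.

(** A row [v] with v X = 0 annihilates the left side of [riemann_inequality], so the Hermitian form
    of Im Z vanishes at [v]. *)
Lemma automorphy_factor_unit : X \in unitmx.
Proof.
rewrite -row_free_unit -kermx_eq0; apply/rowV0P => v /sub_kermxP vX.
apply/eqP/negP => /negP/(siegel_quadratic_gt0 sZ); rewrite ltNge => /negP; apply.
have : v *m (conjmx Z - Z) *m (conjmx v)^T = 0.
  rewrite -riemann_inequality mulmxBr mulmxBl !mulmxA vX !mul0mx sub0r.
  by rewrite -mulmxA -trmx_mul -map_mxM vX map_mx0 trmx0 mulmx0 oppr0.
rewrite conj_sub_quadratic => /eqP; rewrite scaler_eq0 (negPf double_i_neq0).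
by move=> /eqP ->; rewrite mxE.
Qed.

Lemma siegel_quotient : siegel (invmx X *m Y).
Proof.
have uX := automorphy_factor_unit.
have XZ : X *m (invmx X *m Y) = Y by rewrite mulKVmx.
move: (invmx X *m Y) XZ => Z' XZ.
have symZ' : Z'^T = Z'.
  have := riemann_equality; rewrite -XZ trmx_mul.
  rewrite -mulmxA => /(congr1 (fun M => invmx X *m M *m invmx X^T)).
  by rewrite mulKmx// mulmxK ?unitmx_tr// mulKmx// mulmxK ?unitmx_tr.
split=> // x x0.
(* With v = x^T X^-1, the value of Im Z' at the real vector [x] is the value at [v] of the Hermitian
   form of Im Z. *)
have xC0 : map_mx toC x^T *m invmx X != 0.
  apply: contra x0 => /eqP /(congr1 (fun M => M *m X)); rewrite mulmxKV// mul0mx.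
  move/matrixP => E; apply/eqP/matrixP => i j; have := E j i; rewrite !mxE.
  by case.
have := siegel_quadratic_gt0 sZ xC0; set v := _ *m invmx X.
have vX : v *m X = map_mx toC x^T by rewrite mulmxKV.
have E : X *m (conjmx Z' - Z') *m (conjmx X)^T = conjmx Z - Z.
  have Yc : conjmx Y = conjmx X *m conjmx Z' by rewrite -map_mxM XZ.
  rewrite -riemann_inequality Yc trmx_mul [(conjmx Z')^T]map_trmx symZ' -XZ.
  by rewrite mulmxBr mulmxBl !mulmxA.
have : v *m (conjmx Z - Z) *m (conjmx v)^T =
    map_mx toC x^T *m (conjmx Z' - Z') *m (map_mx toC x^T)^T.
  rewrite -E !mulmxA vX -mulmxA -trmx_mul -map_mxM vX; congr (_ *m _^T).
  by apply/matrixP => i j; rewrite !mxE /= oppr0.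
rewrite (conj_sub_quadratic Z) (conj_sub_quadratic Z').
move=> /(scalerI double_i_neq0) ->.
by rewrite [(map_mx toC x^T)^T]map_trmx trmxK -!map_mxM mxE.
Qed.

End Action.

Lemma sp_act_factor Z N : exists X Y : 'M[C]_g,
  row_mx 1%:M Z *m map_mx intr N = row_mx X Y /\ sp_act N Z = invmx X *m Y.
Proof.
set NC : 'M[C]_(g + g) := map_mx intr N.
exists (ulsubmx NC + Z *m dlsubmx NC), (ursubmx NC + Z *m drsubmx NC).
by rewrite -{1}(submxK NC) mul_row_block !mul1mx.
Qed.

End SymplecticAction.

(** * Matrices fixed by the representation *)

Section IntegerMatrices.

Definition o0 : 'I_5 := @Ordinal 5 0 isT.
Definition o1 : 'I_5 := @Ordinal 5 1 isT.
Definition o2 : 'I_5 := @Ordinal 5 2 isT.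
Definition o3 : 'I_5 := @Ordinal 5 3 isT.
Definition o4 : 'I_5 := @Ordinal 5 4 isT.

Lemma ord5P (P : 'I_5 -> Prop) : P o0 -> P o1 -> P o2 -> P o3 -> P o4 ->
  forall i, P i.
Proof.
by move=> p0 p1 p2 p3 p4 [[|[|[|[|[|//]]]]] hi];
  [move: p0|move: p1|move: p2|move: p3|move: p4]; congr P; exact: val_inj.
Qed.

Lemma sum5 (A : nmodType) (F : 'I_5 -> A) :
  \sum_(i < 5) F i = F o0 + F o1 + F o2 + F o3 + F o4.
Proof.
rewrite !big_ord_recr big_ord0 /= add0r.
by do 4?congr (_ + _); congr F; exact: val_inj.
Qed.

(** Explicit entries for the inverse that appears in [rho_r]. *)
Definition R_inv : 'M[int]_5 := mx_of_rows 5
  [:: [:: 0;  2;  2; -1;  1];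
      [:: 0; -1; -1;  1; -1];
      [:: 1;  0;  0;  1;  0];
      [:: 0;  0; -1;  0;  0];
      [:: 0;  2;  1; -2;  1]].

Lemma R_mxV : R_mx *m R_inv = 1%:M.
Proof.
by apply/matrixP; apply: ord5P; apply: ord5P; rewrite !mxE sum5 !mxE.
Qed.

Lemma invmx_R_tr : invmx R_mx^T = R_inv^T.
Proof.
have RR : R_mx^T *m R_inv^T = 1%:M.
  by rewrite -trmx_mul (mulmx1C R_mxV) trmx1.
have [uR _] := mulmx1_unit RR.
by rewrite -[RHS](mulKmx uR) RR mulmx1.
Qed.

End IntegerMatrices.

Section FixedMatrices.
Variable F : numFieldType.

(** Lets [ring] confirm that a solved equation is a given one with its terms rearranged. *)
Lemma eq_of_sub (x y a b : F) : a = b -> x - y = a - b -> x = y.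
Proof. by move=> ->; rewrite subrr => /subr0_eq. Qed.

(** Symmetry leaves 15 entries. Twelve entries of the matrix equation are chosen so that each
    determines one new unknown from earlier ones and the three parameters. *)
Lemma fixed_by_R (Z : 'M[F]_5) : Z^T = Z ->
  map_mx intr R_mx *m Z = Z *m map_mx intr R_inv^T ->
  let u := Z o2 o2 in let v := Z o2 o3 in let w := Z o2 o4 in
  [/\ [/\ Z o0 o0 = 2 * (u + v + w), Z o0 o1 = - w - u, Z o0 o2 = - (2 * v),
      Z o0 o3 = - v - w - u & Z o0 o4 = - v + u],
      [/\ Z o1 o1 = - v + w / 2 + 5 / 4 * u, Z o1 o2 = v - u / 2,
      Z o1 o3 = w + u / 2 & Z o1 o4 = v - u],
      Z o3 o3 = u, Z o3 o4 = - w & Z o4 o4 = 2 * (u - v - w)].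
Proof.
move=> symZ RZ u v w; rewrite /u /v /w.
have s i j : Z j i = Z i j by rewrite -{1}symZ mxE.
have E i j := congr1 (fun M : 'M[F]_5 => M i j) RZ.
have sym := (s o0 o1, s o0 o2, s o0 o3, s o0 o4, s o1 o2, s o1 o3, s o1 o4,
  s o2 o3, s o2 o4, s o3 o4).
(* The digits in each name [eij] give the entry of the matrix equation from which it is read. *)
have e22 : Z o0 o2 = - (2 * Z o2 o3).
  by apply: (eq_of_sub (esym (E o2 o2))); rewrite !mxE !sum5 !mxE /= !sym; ring.
have e23 : Z o3 o3 = Z o2 o2.
  by apply: (eq_of_sub (esym (E o2 o3))); rewrite !mxE !sum5 !mxE /= !sym; ring.
have e32 : Z o0 o3 = Z o0 o2 + Z o2 o3 - Z o2 o4 - Z o3 o3.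
  by apply: (eq_of_sub (esym (E o3 o2))); rewrite !mxE !sum5 !mxE /= !sym; ring.
have e33 : Z o3 o4 = Z o0 o3 + Z o3 o3 + Z o2 o3.
  by apply: (eq_of_sub (esym (E o3 o3))); rewrite !mxE !sum5 !mxE /= !sym; ring.
have e24 : 2 * Z o1 o2 = - Z o3 o4 - Z o2 o2 + 2 * Z o2 o3 - Z o2 o4.
  by apply: (eq_of_sub (esym (E o2 o4))); rewrite !mxE !sum5 !mxE /= !sym; ring.
have e21 : Z o1 o3 = Z o1 o2 + Z o2 o2 - Z o2 o3 + Z o2 o4.
  by apply: (eq_of_sub (esym (E o2 o1))); rewrite !mxE !sum5 !mxE /= !sym; ring.
have e12 : Z o0 o1 = Z o0 o2 + Z o1 o2 + Z o2 o3 - Z o1 o3.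
  by apply: (eq_of_sub (esym (E o1 o2))); rewrite !mxE !sum5 !mxE /= !sym; ring.
have e02 : Z o0 o0 = - Z o0 o2 + Z o2 o2 - Z o2 o3 + Z o2 o4 - Z o0 o3.
  by apply: (eq_of_sub (esym (E o0 o2))); rewrite !mxE !sum5 !mxE /= !sym; ring.
have e42 : Z o0 o4 = - (2 * Z o1 o2) + Z o2 o3 - Z o2 o4 - Z o3 o4.
  by apply: (eq_of_sub (esym (E o4 o2))); rewrite !mxE !sum5 !mxE /= !sym; ring.
have e14 : 2 * Z o1 o1 = Z o0 o4 + Z o3 o4 - Z o1 o2 + 2 * Z o1 o3.
  by apply: (eq_of_sub (esym (E o1 o4))); rewrite !mxE !sum5 !mxE /= !sym; ring.
have e34 : Z o4 o4 = Z o0 o4 - 2 * Z o1 o3 - Z o2 o3 + 2 * Z o3 o3.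
  by apply: (eq_of_sub (esym (E o3 o4))); rewrite !mxE !sum5 !mxE /= !sym; ring.
have e11 : Z o1 o4 = - (2 * Z o1 o1) - Z o1 o2 - Z o0 o1.
  by apply: (eq_of_sub (E o1 o1)); rewrite !mxE !sum5 !mxE /= !sym; ring.
(* [e24] and [e14] determine only twice an entry; these two divisions produce the denominators 2 and
   4. *)
have two0 : (2 : F) != 0 by rewrite pnatr_eq0.
have d : Z o0 o3 = - Z o2 o3 - Z o2 o4 - Z o2 o2 by rewrite e32 e22 e23; ring.
have q : Z o3 o4 = - Z o2 o4 by rewrite e33 d e23; ring.
have h12 : Z o1 o2 = Z o2 o3 - Z o2 o2 / 2.
  by apply: (mulfI two0); rewrite e24 q; field.
have h13 : Z o1 o3 = Z o2 o4 + Z o2 o2 / 2 by rewrite e21 h12; field.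
have h01 : Z o0 o1 = - Z o2 o4 - Z o2 o2 by rewrite e12 e22 h12 h13; field.
have h04 : Z o0 o4 = - Z o2 o3 + Z o2 o2 by rewrite e42 h12 q; field.
have h11 : Z o1 o1 = - Z o2 o3 + Z o2 o4 / 2 + 5 / 4 * Z o2 o2.
  by apply: (mulfI two0); rewrite e14 h04 q h12 h13; field.
split; [split|split| | |] => //.
- by rewrite e02 e22 d; ring.
- by rewrite e11 h11 h12 h01; field.
- by rewrite e34 h04 h13 e23; field.
Qed.

End FixedMatrices.

Lemma fixed_by_R_uvw (R : realType) (Z : 'M[Cplx R]_5) : Z^T = Z ->
  map_mx intr R_mx *m Z = Z *m map_mx intr R_inv^T ->
  Z = Z_uvw (Z o2 o2) (Z o2 o3) (Z o2 o4).
Proof.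
move=> symZ RZ; have s i j : Z j i = Z i j by rewrite -{1}symZ mxE.
have [[e00 e01 e02 e03 e04] [e11 e12 e13 e14] e33 e34 e44] := fixed_by_R symZ RZ.
have sym := (s o0 o1, s o0 o2, s o0 o3, s o0 o4, s o1 o2, s o1 o3, s o1 o4,
  s o2 o3, s o2 o4, s o3 o4).
apply/matrixP; apply: ord5P; apply: ord5P; rewrite [RHS]mxE /= ?sym;
  by rewrite ?e00 ?e01 ?e02 ?e03 ?e04 ?e11 ?e12 ?e13 ?e14 ?e33 ?e34 ?e44.
Qed.

(** * Transfer to the Shimura family and conclusion *)

Lemma period_matrix_periods (R : realType) (S : riemann_surface R) (g : nat)
    (w : 'I_g -> S -> Cplx R) (d : 'I_(g + g) -> R -> S) (Z : 'M[Cplx R]_g) :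
  (forall i j, path_integral (w i) (d (lshift g j)) = (i == j)%:R /\
               path_integral (w i) (d (rshift g j)) = Z i j) ->
  periods w d = row_mx 1%:M Z.
Proof.
move=> H; apply/matrixP => i j; rewrite mxE; case: (split_ordP j) => k ->.
  by rewrite row_mxEl mxE (H i k).1.
by rewrite row_mxEr (H i k).2.
Qed.

Lemma shimura_action (R : realType) (g : nat) (ZS Z A : 'M[Cplx R]_g)
    (N M : 'M[int]_(g + g)) : symplectic N ->
  A *m (row_mx 1%:M ZS *m map_mx intr N) =
    row_mx 1%:M ZS *m map_mx intr N *m map_mx intr M ->
  shimura_family ZS Z ->
  exists A' : 'M[Cplx R]_g, A' *m (row_mx 1%:M Z *m map_mx intr N) =
    row_mx 1%:M Z *m map_mx intr N *m map_mx intr M.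
Proof.
move=> sN EA [_ shim]; have VN := symplectic_mulV sN.
pose Q : 'M[rat]_(g + g) := map_mx intr (N *m M *m symplectic_inv N).
have QE : map_mx ratr Q = map_mx intr N *m map_mx intr M *m
    map_mx intr (symplectic_inv N) :> 'M[Cplx R]_(g + g).
  by rewrite -!map_mxM; apply/matrixP => i j; rewrite !mxE ratr_int.
have VNC : map_mx intr (symplectic_inv N) *m map_mx intr N = 1%:M
    :> 'M[Cplx R]_(g + g).
  by rewrite -map_mxM VN map_mx1.
have [A' EA'] : rational_endomorphism Z Q.
  apply: shim; exists A; rewrite QE !mulmxA -EA -!mulmxA.
  by rewrite (mulmx1C VNC) mulmx1.
by exists A'; rewrite mulmxA EA' QE -!mulmxA VNC mulmx1.
Qed.

Theorem corollary2 (R : realType) (S : riemann_surface R) (r s : S -> S)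
    (b : chain S -> chain S -> int) (c d : 'I_(5 + 5) -> R -> S)
    (ZS Z : 'M[Cplx R]_5) :
  F5 S ->
  dihedral_generators 10 r s ->
  intersection_form b ->
  symplectic_basis b c -> acts_by_rho c r s ->
  symplectic_basis b d -> period_matrix d ZS ->
  shimura_family ZS Z ->
  exists N : 'M[int]_(5 + 5),
    [/\ symplectic N, coordinates d c N, siegel (sp_act N Z)
      & exists u v w : Cplx R, sp_act N Z = Z_uvw u v w].
Proof.
move=> _ [[hr _] _ _ _] bi bc [rc _] bd [w [bw Pw]] shim.
have [N [sN dcN]] := symplectic_basis_change (g := 4) bi bc bd.
exists N; have cC1 i : C1_map (c i) by have [/(_ i)[]] := bc.1.
have dC1 i : C1_map (d i) by have [/(_ i)[]] := bd.1.
have [A EA] := periods_automorphism bw cC1 hr rc.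
rewrite (periods_coordinates bw.1 cC1 dC1 dcN) (period_matrix_periods Pw) in EA.
have [A' EA'] := shimura_action sN EA shim.
have [X [Y [EXY ->]]] := sp_act_factor Z N.
have uX := automorphy_factor_unit shim.1 sN EXY.
have sZ' := siegel_quotient shim.1 sN EXY.
rewrite EXY /rho_r invmx_R_tr map_block_mx !map_mx0 mul_row_block in EA'.
rewrite !mulmx0 addr0 add0r mul_mx_row in EA'.
have [EX EY] := eq_row_mx EA'.
split; [exact: sN|exact: dcN|exact: sZ'|].
(* [EX] gives A' = X R X^-1; substituting this in [EY] eliminates A'. *)
have RZ : map_mx intr R_mx *m (invmx X *m Y) =
    invmx X *m Y *m map_mx intr R_inv^T.
  by rewrite -mulmxA -EY -[A' in RHS](mulmxK uX) EX -!mulmxA mulKmx.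
by do 3 eexists; exact: (fixed_by_R_uvw sZ'.1 RZ).
Qed.
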